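(* Let $k$ be an infinite field of characteristic $p>0$, let $q=p^e>1$ be a power of $p$, and for $i=1,\ldots,4$ let $d_i=k_iq+r_i$ with integers $1\le k_i\le p-1$, $0\le r_i\le q-1$ such that $$k_i\le\left\lfloor\frac{\sum_{j=1}^{4}k_j-2}{2}\right\rfloor\quad\text{for all } i\in\{1,\ldots,4\},$$ and assume $r_1\le r_2\le r_3\le r_4$. Then the ring $A=k[x_1,\ldots,x_4]/(x_1^{d_1},\ldots,x_4^{d_4})$ has the weak Lefschetz property if and only if one of the following holds: (a) $\sum_{i=1}^4k_i$ is odd, $r_1+r_2+r_3-r_4+2\ge q\ge r_2+r_3+r_4-r_1-2$, and $pq\ge\left\lceil\frac{\sum_{i=1}^4d_i-2}{2}\right\rceil$; (b) $\sum_{i=1}^4k_i$ is even, $2q-2\le r_1+r_2+r_3+r_4\le 2q+2$, $r_3+r_4\le r_1+r_2+2$, and $pq\ge\left\lceil\frac{\sum_{i=1}^4d_i-2}{2}\right\rceil$.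
   Context: A standard graded algebra $A=\oplus_i A_i$ has the weak Lefschetz property (WLP) if there exists $L\in A_1$ such that the multiplication map $\times L:A_i\to A_{i+1}$ has maximal rank (i.e. is injective or surjective) for every $i$. *)

(* Defs.v *)
From HB Require Import structures.
From mathcomp Require Import all_boot all_order all_algebra.
From mathcomp Require Import boolp classical_sets cardinality.
From mathcomp Require Import ring_quotient.
From mathcomp Require Import mpoly.

Set Implicit Arguments.
Unset Strict Implicit.
Unset Printing Implicit Defensive.

Import GRing.Theory.

Local Open Scope ring_scope.

(* [A_ i] is the degree-[i] component of [A].  The rank of the multiplication
   map is maximal when the map is injective or surjective. *)
Definition mult_injective (A : comNzRingType) (A_ : nat -> A -> Prop)
    (L : A) (i : nat) : Prop :=
  forall a b : A, A_ i a -> A_ i b -> L * a = L * b -> a = b.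

Definition mult_surjective (A : comNzRingType) (A_ : nat -> A -> Prop)
    (L : A) (i : nat) : Prop :=
  forall c : A, A_ i.+1 c -> exists2 a : A, A_ i a & L * a = c.

Definition weak_Lefschetz (A : comNzRingType) (A_ : nat -> A -> Prop) : Prop :=
  exists2 L : A, A_ 1%N L &
    forall i : nat, mult_injective A_ L i \/ mult_surjective A_ L i.

Section MonomialCompleteIntersection.
Variables (K : fieldType) (n : nat) (d : 'I_n -> nat).

Definition power_ideal : pred {mpoly K[n]} := fun f =>
  `[< exists c : 'I_n -> {mpoly K[n]}, f = \sum_(i < n) c i * 'X_i ^+ d i >].

(* [idealr] is the structure of proper ideals, and [{ideal_quot _}] is a
   nonzero ring: this is where positive exponents are needed. *)
Hypothesis d_gt0 : forall i, (0 < d i)%N.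

Lemma power_ideal_closed : idealr_closed power_ideal.
Proof.
split.
- by apply/asboolP; exists (fun=> 0); rewrite big1 // => i _; rewrite mul0r.
- apply/negP => /asboolP [c /(congr1 (fun f => f.@[fun=> 0]))].
  rewrite meval1 raddf_sum /= big1 => [/eqP|i _]; first by rewrite oner_eq0.
  by rewrite mevalM rmorphXn /= mevalXU expr0n eqn0Ngt d_gt0 mulr0.
- move=> a f g /asboolP [c ->] /asboolP [c' ->]; apply/asboolP.
  exists (fun i => a * c i + c' i); rewrite mulr_sumr -big_split /=.
  by apply: eq_bigr => i _; rewrite mulrDl mulrA.
Qed.

Definition power_idealr : idealr {mpoly K[n]} :=
  HB.pack power_ideal
    (isIdealr.Build {mpoly K[n]} power_ideal power_ideal_closed).

Definition monomial_ci : comNzRingType := {ideal_quot power_idealr}.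

(* The grading inherited from K[x_1, ..., x_n]. *)
Definition monomial_ci_deg (i : nat) (a : monomial_ci) : Prop :=
  exists2 f : {mpoly K[n]}, f \is i.-homog & a = \pi_{ideal_quot power_idealr}%qT f.

End MonomialCompleteIntersection.

(* Main.v *)
Require Import Defs.
From mathcomp Require Import all_boot all_order all_algebra.
From mathcomp Require Import boolp classical_sets cardinality.
From mathcomp Require Import ring_quotient mpoly.
From mathcomp Require Import zify ring.

(** Let [s] be the sum of the [d i - 1], the socle degree of [A].  Duality in
    the Artinian Gorenstein algebra [A] reduces the weak Lefschetz property to
    one statement: some linear form [l] is injective on [A_i] whenever
    [2 * i < s].  Both directions then rest on splitting [A] as the tensor
    product of [M = K[x1, x2] / (x1^d1, x2^d2)] and
    [N = K[x3, x4] / (x3^d3, x4^d4)] and [l] as [T + T'], with [T] acting on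
    [M] and [T'] on [N].

    Necessity.  If [T] to the power [C + 1] kills a nonzero [g] of degree [u]
    in [M] and [T'] to the power [C + 1] kills a nonzero [h] of degree [v] in
    [N], then for the least such [C] the alternating sum of the products of
    [T^j g] and [T'^(C - j) h] is a nonzero element of the kernel of [l]
    ([pair_kernel]), so [s <= 2 * (u + v + C)].  Characteristic [p] provides
    strings [g], [T g], ... that end too early: since the [q]-th power of a
    linear form in [x1, x2] is a linear form in [x1^q, x2^q], a polynomial of
    small degree in [x1^q, x2^q] that is killed by a power of that form for
    dimension reasons, multiplied by suitable powers of [x1] and [x2], is such
    a string ([frobenius_string]).  One may replace [d i] by either of the two
    neighbouring multiples [k i * q] and [(k i + 1) * q]; the choices none,
    all, [{4}], [{2, 3, 4}] and [{3, 4}] for the set of indices that are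
    rounded up give the five inequalities between [q] and the [r i], and the
    same construction with [p * q] in place of [q] and [g = h = 1] gives the
    bound on [p * q].

    Sufficiency.  The inequalities force every [r i] to be close to [q / 2].
    For odd [p] and [q = 2 * h + 1], either every [r i] is [h] or [h + 1], or
    exactly one is off by one more, and then [s] is even ([remainder_cases]).
    When both remainders are [h] or [h + 1], the powers of [x1 + x2] have
    maximal rank on [M], as in characteristic zero, as long as they do not
    reach degree [p * q] ([powers_injective_central]): the relevant
    determinant of binomial coefficients has a product formula ([det_binmx]),
    and all its [p]-adic contributions cancel because [d1] and [d2] are as
    close as integers can be to the point half-way between two multiples of
    each power [p^f] with [1 <= f <= e] ([sum_divn_central]).  The
    exceptional remainder costs one degree, which the parity of [s] makes up
    for.  For [p = 2] only the exponents 2, 2, 3, 3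
    satisfy the inequalities, and grouping them as two pairs (2, 3) makes the
    same argument apply.  Finally, a kernel element of [T + T'] of
    degree below [s / 2] vanishes because [T^c] and the opposite of [T'] to
    the power [c] agree on it, one being injective where the other must
    vanish ([pair_injective]). *)

Set Implicit Arguments.
Unset Strict Implicit.
Unset Printing Implicit Defensive.
Import GRing.Theory Num.Theory.

(** * Determinants of binomial coefficients *)

Section BinomialDeterminant.
Local Open Scope ring_scope.

(** The matrix is a Vandermonde matrix times the matrix of coefficients, and a
    Vandermonde determinant depends on the differences of the nodes only. *)
Lemma det_poly_eval_shift (R : comNzRingType) (m : nat) (P : 'I_m -> {poly R})
    (x : 'I_m -> R) (t : R) :
  (forall j, (size (P j) <= m)%N) ->
  \det (\matrix_(i < m, j < m) (P j).[x i + t]) =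
  \det (\matrix_(i < m, j < m) (P j).[x i]).
Proof.
move=> sP.
have E (y : 'I_m -> R) : \matrix_(i < m, j < m) (P j).[y i] =
   (Vandermonde m (\row_i y i))^T *m \matrix_(l < m, j < m) (P j)`_l.
  apply/matrixP=> i j; rewrite !mxE (horner_coef_wide _ (sP j)).
  by apply: eq_bigr => l _; rewrite !mxE mulrC.
rewrite !E !det_mulmx !det_tr !det_Vandermonde; congr (_ * _).
apply: eq_bigr => i _; apply: eq_bigr => j _; rewrite !mxE.
by rewrite opprD addrACA subrr addr0.
Qed.

Definition ffact_poly (R : comNzRingType) (n : nat) : {poly R} :=
  \prod_(t < n) ('X - (t%:R)%:P).

Lemma size_ffact_poly (R : comNzRingType) n : size (ffact_poly R n) = n.+1.
Proof. by rewrite /ffact_poly size_prod_XsubC /= /index_enum -enumT size_enum_ord. Qed.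

Lemma horner_ffact_poly (R : comNzRingType) n k :
  (ffact_poly R n).[k%:R] = (k ^_ n)%:R.
Proof.
rewrite /ffact_poly horner_prod ffact_prod natr_prod.
case: (leqP n k) => [le_nk | lt_kn].
  apply: eq_bigr => i _; rewrite !hornerE natrB //.
  by rewrite ltnW // (leq_trans (ltn_ord i)).
rewrite (bigD1 (Ordinal lt_kn)) //= !hornerE subrr mul0r.
by rewrite (bigD1 (Ordinal lt_kn)) //= subnn mul0r.
Qed.

(** By translation invariance one may take [u = 0], where the matrix is triangular. *)
Lemma det_ffact_mul (m u c : nat) : (u <= c)%N ->
  \det (\matrix_(i < m, j < m)
     (((u + i) ^_ j * (c + m.-1 - (u + i)) ^_ (m.-1 - j))%:R : int)) =
  (\prod_(i < m) (i`! * (c + m.-1 - i) ^_ (m.-1 - i)))%:R.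
Proof.
move=> le_uc; pose C := (c + m.-1)%N.
pose P (j : 'I_m) : {poly int} :=
  ffact_poly int j * (ffact_poly int (m.-1 - j) \Po ((C%:R)%:P - 'X)).
have sX : size ((C%:R)%:P - 'X : {poly int}) = 2.
  by rewrite -opprB size_polyN size_XsubC.
have sP j : (size (P j) <= m)%N.
  have := ltn_ord j => lt_jm; apply: leq_trans (size_polyMleq _ _) _.
  have := size_comp_poly2 (ffact_poly int (m.-1 - j)) sX.
  rewrite !size_ffact_poly => ->; lia.
have PE (n : nat) j : (n <= C)%N ->
    (P j).[n%:R] = (n ^_ j * (C - n) ^_ (m.-1 - j))%:R.
  move=> le_nC; rewrite /P hornerM horner_comp !hornerE -natrB //.
  by rewrite !horner_ffact_poly natrM.
have -> : \matrix_(i < m, j < m) (((u + i) ^_ j *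
     (c + m.-1 - (u + i)) ^_ (m.-1 - j))%:R : int) =
   \matrix_(i < m, j < m) (P j).[(i : nat)%:R + u%:R].
  apply/matrixP=> i j; rewrite !mxE -natrD PE; last by have := ltn_ord i; rewrite /C; lia.
  by rewrite (addnC i).
rewrite det_poly_eval_shift // det_trig; last first.
  apply/is_trig_mxP => i j lt_ij; rewrite mxE PE; last first.
    by have := ltn_ord i; rewrite /C; lia.
  by rewrite (@ffact_small i j) ?mul0n.
rewrite natr_prod; apply: eq_bigr => i _; rewrite mxE PE ?ffactnn //.
by have := ltn_ord i; rewrite /C; lia.
Qed.

(** The matrix, in monomial bases, of the multiplication by [(X + 1)^c] from the
    polynomials of degree less than [m] to the coefficients of [X^u, ..., X^(u + m - 1)]. *)
Definition binmx (R : pzSemiRingType) (m u c : nat) : 'M[R]_m :=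
  \matrix_(i < m, j < m) (if (j <= u + i)%N then 'C(c, u + i - j) else 0%N)%:R.

Lemma bin_mul_fact (m u v i j : nat) : (i < m)%N -> (j < m)%N ->
  ((if j <= u + i then 'C(u + v, u + i - j) else 0) *
     ((u + i)`! * (v + (m.-1 - i))`!) =
   (u + v)`! * ((u + i) ^_ j * (u + v + m.-1 - (u + i)) ^_ (m.-1 - j)))%N.
Proof.
move=> lt_im lt_jm.
have -> : (u + v + m.-1 - (u + i) = v + (m.-1 - i))%N by lia.
case: ifP => le_j; last by rewrite mul0n ffact_small ?muln0 //; lia.
case: (leqP (u + i - j) (u + v)) => le_uv; last first.
  by rewrite bin_small // (@ffact_small (v + (m.-1 - i))%N) ?muln0 //; lia.
rewrite -(ffact_fact le_j) -(@ffact_fact (v + (m.-1 - i))%N (m.-1 - j)%N); last lia.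
rewrite -(bin_fact le_uv).
have -> : (v + (m.-1 - i) - (m.-1 - j) = u + v - (u + i - j))%N by lia.
nia.
Qed.

(** Multiplying each row by two factorials turns binomial coefficients
    into products of falling factorials, that is, into values of polynomials of
    degree less than [m]. *)
Lemma det_binmx (m u v : nat) :
  \det (binmx int m u (u + v)) * (\prod_(i < m) ((u + i)`! * (v + i)`!))%:R =
  (\prod_(i < m) (i`! * (u + v + i)`!))%:R.
Proof.
have rev (F : nat -> nat) : (\prod_(i < m) F (m.-1 - i) = \prod_(i < m) F i)%N.
  rewrite (reindex_inj rev_ord_inj); apply: eq_bigr => i _ /=.
  by congr F; have := ltn_ord i; lia.
have -> : (\prod_(i < m) ((u + i)`! * (v + i)`!) =
    \prod_(i < m) ((u + i)`! * (v + (m.-1 - i))`!))%N.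
  by rewrite !big_split /= (rev (fun i => (v + i)`!)).
have -> : (\prod_(i < m) (i`! * (u + v + i)`!) = ((u + v)`!) ^ m *
    \prod_(i < m) (i`! * (u + v + m.-1 - i) ^_ (m.-1 - i)))%N.
  rewrite -[X in (_ ^ X)%N](card_ord m) -prod_nat_const -big_split /=.
  rewrite !big_split /= -(rev (fun i => (u + v + i)`!)) mulnCA; congr muln.
  rewrite -big_split /=; apply: eq_bigr => i _.
  have -> : (u + v + m.-1 - i = u + v + (m.-1 - i))%N by have := ltn_ord i; lia.
  by rewrite -(@ffact_fact _ (m.-1 - i)%N) ?leq_addl // addnK mulnC.
rewrite natrM -(det_ffact_mul m (leq_addr v u)).
have -> : (\prod_(i < m) ((u + i)`! * (v + (m.-1 - i))`!))%:R =
   \det (diag_mx (\row_(i < m) (((u + i)`! * (v + (m.-1 - i))`!)%:R : int))).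
  by rewrite det_diag natr_prod; apply: eq_bigr => i _; rewrite mxE.
rewrite mulrC -det_mulmx natrX -detZ; congr (\det _); apply/matrixP=> i j.
rewrite mul_diag_mx !mxE -!natrM; congr (_%:R).
by rewrite -(bin_mul_fact u v (ltn_ord i) (ltn_ord j)) mulnC.
Qed.

Lemma det_binmx_neq0 (F : fieldType) (p : nat) (m u v : nat) : p \in [pchar F] ->
  (logn p (\prod_(i < m) (i`! * (u + v + i)`!)) =
   logn p (\prod_(i < m) ((u + i)`! * (v + i)`!)))%N ->
  \det (binmx F m u (u + v)) != 0.
Proof.
move=> pF eq_logn.
have -> : binmx F m u (u + v) = map_mx intr (binmx int m u (u + v)).
  by apply/matrixP=> i j; rewrite !mxE rmorph_nat.
have pos (G : nat -> nat) : (forall i, 0 < G i)%N -> (0 < \prod_(i < m) G i)%N.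
  by move=> G0; rewrite prodn_gt0.
have /(congr1 (fun z : int => `|z|%N)) := det_binmx m u v.
rewrite det_map_mx abszM !natz !absz_nat; set D := \det _ => ED.
have posN : (0 < \prod_(i < m) (i`! * (u + v + i)`!))%N.
  by apply: (pos (fun i => i`! * (u + v + i)`!)%N) => i; rewrite muln_gt0 !fact_gt0.
have D0 : (0 < `|D|)%N by case: `|D|%N ED posN => // <-.
move: eq_logn; rewrite -ED lognM //; last first.
  by apply: (pos (fun i => (u + i)`! * (v + i)`!)%N) => i; rewrite muln_gt0 !fact_gt0.
move=> /eqP; rewrite -[X in _ == X]add0n eqn_add2r => /eqP lognD.
have : ~~ (p %| `|D|)%N.
  by rewrite -[p]expn1 pfactor_dvdn ?lognD // (pcharf_prime pF).
rewrite (dvdn_pcharf pF); apply: contra => /eqP.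
case: (intP D) => [|n|n]; rewrite ?rmorph0 ?abszN ?absz_nat //.
  by move=> E; rewrite -E.
by rewrite rmorphN /= => /eqP; rewrite oppr_eq0.
Qed.

End BinomialDeterminant.

(** * Valuations of products of factorials *)

(** [(a, b)] lies within distance one, in each of the two diagonal directions, of the
    centre of a cell of the square lattice of mesh [Q]. *)
Definition central (Q a b : nat) : Prop :=
  [/\ a %% Q <= b %% Q + 1, b %% Q <= a %% Q + 1,
      Q <= a %% Q + b %% Q + 1 & a %% Q + b %% Q <= Q + 1].

(** The residue function [r * (Q - r)] enters twice as the correction term in the
    closed form of a sum of quotients by [Q].  If no sum of residues wrapped around,
    this would be a polynomial identity; the closeness to the centre of a cell is
    what makes the contributions of the wraps cancel. *)
Lemma residue_identity (Q r1 r2 mu x y w v : nat) :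
  r1 <= r2 + 1 -> r2 <= r1 + 1 -> Q <= r1 + r2 + 1 -> r1 + r2 <= Q + 1 ->
  r1 < Q -> r2 < Q -> mu < Q -> x < Q -> y < Q -> w < Q -> v < Q ->
  (x + mu = r1 \/ x + mu = r1 + Q) -> (y + mu = r2 \/ y + mu = r2 + Q) ->
  (x + y = w \/ x + y = w + Q) -> (w + mu = v \/ w + mu = v + Q) ->
  (v + mu + x + y) * Q + (w * w + r1 * r1 + r2 * r2) =
  (w + r1 + r2) * Q + (v * v + mu * mu + x * x + y * y).
Proof.
move=> h1 h2 h3 h4 l1 l2 l3 l4 l5 l6 l7 e1 e2 e3 e4.
have bit (m n : nat) : m = n \/ m = n + Q ->
    exists2 e : int, (Posz m = Posz n + e * Posz Q)%R & (e = 0 \/ e = 1)%R.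
  by case=> ->; [exists 0%R | exists 1%R]; first [lia | by left | by right].
move: (bit _ _ e1) (bit _ _ e2) (bit _ _ e3) (bit _ _ e4).
move=> [e ex e01] [f fy f01] [g gw g01] [h hv h01].
(* [e], [f], [g], [h] count the wraps; the quadratic identity is [Q] times this linear one *)
have L : (2 * (e * (Posz r1 - Posz mu) + f * (Posz r2 - Posz mu) +
     (e + f - g - h) * (Posz r1 + Posz r2 - Posz mu) -
     (e + f - g) * (Posz r1 + Posz r2 - 2 * Posz mu)) =
   ((e + f - g - h) * (1 - (e + f - g - h)) -
    (e + f - g) * (1 - (e + f - g))) * Posz Q)%R.
  by case: e01 => ee; case: f01 => ff; case: g01 => gg; case: h01 => hh; subst e f g h; lia.
have {L} := congr1 (GRing.mul (Posz Q)) L.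
have [xE yE] : Posz x = (Posz r1 - Posz mu + e * Posz Q)%R /\
   Posz y = (Posz r2 - Posz mu + f * Posz Q)%R by lia.
have wE : Posz w = (Posz r1 + Posz r2 - 2 * Posz mu + (e + f - g) * Posz Q)%R by lia.
have vE : Posz v = (Posz r1 + Posz r2 - Posz mu + (e + f - g - h) * Posz Q)%R by lia.
move=> L; apply/eqP; rewrite -eqz_nat !PoszD !PoszM !PoszD xE yE wE vE; apply/eqP.
apply/eqP; rewrite -subr_eq0; apply/eqP.
have idem (t : int) : (t = 0 \/ t = 1)%R -> (t - t * t = 0)%R by case=> ->.
move: L => /eqP; rewrite -subr_eq0 => /eqP L.
transitivity (((e - e * e) + (f - f * f)) * (Posz Q * Posz Q) - (
   Posz Q * (2 * (e * (Posz r1 - Posz mu) + f * (Posz r2 - Posz mu) +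
     (e + f - g - h) * (Posz r1 + Posz r2 - Posz mu) -
     (e + f - g) * (Posz r1 + Posz r2 - 2 * Posz mu))) -
   Posz Q * (((e + f - g - h) * (1 - (e + f - g - h)) -
    (e + f - g) * (1 - (e + f - g))) * Posz Q)))%R; first by ring.
by rewrite L (idem _ e01) (idem _ f01); ring.
Qed.

Definition divn_sum (Q n : nat) : nat := \sum_(i < n) i %/ Q.

Lemma divn_sum_shift Q u m :
  \sum_(i < m) (u + i) %/ Q + divn_sum Q u = divn_sum Q (u + m).
Proof.
by rewrite addnC /divn_sum big_split_ord.
Qed.

Lemma divn_sum_closed (Q n : nat) : 0 < Q ->
  2 * Q * divn_sum Q n + Q * n + (n %% Q) * (n %% Q) = n * n + (n %% Q) * Q.
Proof.
move=> Q0; elim: n => [|n IH]; first by rewrite /divn_sum big_ord0 mod0n !muln0.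
rewrite /divn_sum big_ord_recr /= -/(divn_sum Q n).
have := divn_eq n Q; have := ltn_pmod n Q0.
set r := n %% Q in IH *; set k := n %/ Q => lt_rQ nE.
case: (ltngtP r.+1 Q) => [lt_r | | eq_r]; last 1 first.
- have -> : n.+1 %% Q = 0 by rewrite nE -addnS eq_r -mulSnr modnMl.
  nia.
- have -> : n.+1 %% Q = r.+1 by rewrite nE -addnS modnMDl modn_small.
  nia.
- lia.
Qed.

(** This is the contribution of [Q = p^f] to the [p]-adic valuations of the two
    products of factorials in [det_binmx]. *)
Lemma sum_divn_central (Q a b m : nat) : 0 < Q -> central Q a b ->
  m <= a -> m <= b ->
  \sum_(i < m) (i %/ Q + (a + b - 2 * m + i) %/ Q) =
  \sum_(i < m) ((a - m + i) %/ Q + (b - m + i) %/ Q).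
Proof.
move=> Q0 [h1 h2 h3 h4] le_ma le_mb; rewrite !big_split /=.
have := divn_sum_shift Q (a + b - 2 * m) m.
have := divn_sum_shift Q (a - m) m; have := divn_sum_shift Q (b - m) m.
rewrite -/(divn_sum Q m); set Sa := \sum_(i < m) _; set Sb := \sum_(i < m) _.
set Sc := \sum_(i < m) _; rewrite !subnK //.
have -> : a + b - 2 * m + m = a + b - m by lia.
have wrap u v : (u %% Q + v %% Q = (u + v) %% Q \/
                 u %% Q + v %% Q = (u + v) %% Q + Q).
  by rewrite modnD //; case: leqP; [right | left]; lia.
have := @residue_identity Q (a %% Q) (b %% Q) (m %% Q) ((a - m) %% Q)
  ((b - m) %% Q) ((a + b - 2 * m) %% Q) ((a + b - m) %% Q).
move=> /(_ h1 h2 h3 h4); do 7! move=> /(_ (ltn_pmod _ Q0)).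
have := wrap (a - m) m; rewrite subnK // => H; move=> /(_ H) {H}.
have := wrap (b - m) m; rewrite subnK // => H; move=> /(_ H) {H}.
have := wrap (a - m) (b - m); have -> : a - m + (b - m) = a + b - 2 * m by lia.
move=> H; move=> /(_ H) {H}.
have := wrap (a + b - 2 * m) m; have -> : a + b - 2 * m + m = a + b - m by lia.
move=> H; move=> /(_ H) {H}.
have := divn_sum_closed a Q0; have := divn_sum_closed b Q0.
have := divn_sum_closed m Q0; have := divn_sum_closed (a - m) Q0.
have := divn_sum_closed (b - m) Q0; have := divn_sum_closed (a + b - 2 * m) Q0.
have := divn_sum_closed (a + b - m) Q0.
move: (divn_sum Q m) (divn_sum Q a) (divn_sum Q b) (divn_sum Q (a - m)).
move: (divn_sum Q (b - m)) (divn_sum Q (a + b - 2 * m)) (divn_sum Q (a + b - m)).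
move: (a %% Q) (b %% Q) (m %% Q) ((a - m) %% Q) ((b - m) %% Q).
move: ((a + b - 2 * m) %% Q) ((a + b - m) %% Q).
move=> w v r1 r2 mu x y Gv Gw Gy Gm Ga Gb Gx.
have [u uE] : exists u, u = a - m by exists (a - m).
have [t tE] : exists t, t = b - m by exists (b - m).
have -> : a + b - 2 * m = u + t by lia.
have -> : a + b - m = u + t + m by lia.
have -> : a = u + m by lia.
have -> : b = t + m by lia.
rewrite !addnK => {uE tE} Ev Ew Ey Ex Em Eb Ea R S1 S2 S3.
apply/eqP; rewrite -(@eqn_pmul2l (2 * Q)) ?muln_gt0 //; apply/eqP.
nia.
Qed.

Lemma logn_prod_fact (p e m : nat) (F : nat -> nat) : prime p ->
  (forall i, i < m -> F i < p ^ e.+1) ->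
  logn p (\prod_(i < m) (F i)`!) = \sum_(1 <= f < e.+1) \sum_(i < m) F i %/ p ^ f.
Proof.
move=> pr_p; elim: m => [|m IH] ltF.
  by rewrite big_ord0 logn1 big1 // => f _; rewrite big_ord0.
rewrite big_ord_recr /= lognM ?fact_gt0 ?prodn_gt0 //; last by move=> i; rewrite fact_gt0.
rewrite IH => [|i lt_im]; last by apply: ltF; rewrite ltnW.
under [RHS]eq_bigr => f _ do rewrite big_ord_recr /=.
rewrite big_split /=; congr addn; rewrite logn_fact //.
have lt1 := ltF m (ltnSn m); set N := F m in lt1 *.
have extend k : k <= N + e.+1 -> N < p ^ k ->
    \sum_(1 <= f < k) N %/ p ^ f = \sum_(1 <= f < (N + e).+1) N %/ p ^ f.
  case: k => [|k] le_k lt_N.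
    have -> : N = 0 by move: lt_N; rewrite expn0; case: (N).
    by rewrite !big1 // => f _; rewrite div0n.
  rewrite [RHS](@big_cat_nat _ _ _ k.+1) //=; last by move: le_k; rewrite addnS ltnS.
  rewrite -[LHS]addn0; congr addn; apply/esym; rewrite big_nat_cond big1 //.
  move=> f; rewrite andbT => /andP[le_kf _]; apply: divn_small.
  by apply: leq_trans lt_N _; rewrite leq_exp2l // prime_gt1.
rewrite !extend ?leq_addl // ?addnS ?ltnS ?leq_addr //.
by apply: ltn_trans (ltnSn N) (ltn_expl _ (prime_gt1 pr_p)).
Qed.

Lemma logn_fact_central (p e a b m : nat) : prime p ->
  (forall f, 1 <= f <= e -> central (p ^ f) a b) ->
  m <= a -> m <= b -> a + b - m <= p ^ e.+1 ->
  logn p (\prod_(i < m) (i`! * (a - m + (b - m) + i)`!)) =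
  logn p (\prod_(i < m) ((a - m + i)`! * (b - m + i)`!)).
Proof.
move=> pr_p cen le_ma le_mb le_ab; rewrite !big_split /=.
have pos (F : nat -> nat) : 0 < \prod_(i < m) (F i)`!.
  by rewrite prodn_gt0 // => i; rewrite fact_gt0.
rewrite !lognM ?pos // ?(pos (fun i => i)) //.
rewrite (@logn_prod_fact p e m (fun i => i)) // ?(@logn_prod_fact p e) //;
  try by move=> i lt_i; lia.
rewrite -!big_split /=; rewrite big_nat_cond [RHS]big_nat_cond.
apply: eq_bigr => f; rewrite andbT ltnS => f_e; rewrite -!big_split /=.
have -> : a - m + (b - m) = a + b - 2 * m by lia.
by apply: sum_divn_central; rewrite ?expn_gt0 ?prime_gt0 //; apply: cen.
Qed.

(** * Injectivity of powers of a linear form in two variables *)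

Section Strings.
Local Open Scope ring_scope.
Variable K : fieldType.
Implicit Types (f g P : {poly K}).

(** [P] stands for the form of degree [d] in [x, z] obtained by homogenizing: the
    condition is membership in the ideal [(x^a, z^b)]. *)
Definition zero_in_box P (a b d : nat) : Prop :=
  forall w : nat, (w < a)%N -> (d < w + b)%N -> P`_w = 0.

(** On [K[x, z] / (x^a, z^b)], of socle degree [a + b - 2], the map [(x + z)^c] is
    injective on degree [j] as long as its target is not above the mirror image of
    its source.  The bound [Q] takes into account that [(x + z)^Q] is zero when [Q]
    is a power of the characteristic not less than [a] and [b]; the defect [t]
    shortens the range of degrees. *)
Definition powers_injective (Q a b t : nat) : Prop :=
  forall (j c : nat) f, (size f <= j.+1)%N -> (2 * j + c + 2 + t <= a + b)%N ->
    (j + c < Q)%N -> zero_in_box (('X + 1) ^+ c * f) a b (j + c) -> zero_in_box f a b j.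

Lemma coef_X1_mul P i :
  (('X + 1) * P)`_i = (if i is i'.+1 then P`_i' else 0) + P`_i.
Proof. by rewrite mulrDl mul1r coefD coefXM; case: i. Qed.

Lemma coef_X1_exp c i : (('X + 1 : {poly K}) ^+ c)`_i = 'C(c, i)%:R.
Proof.
elim: c i => [|c IH] i; first by rewrite expr0 coef1 bin0n.
rewrite exprS coef_X1_mul IH; case: i => [|i]; first by rewrite !bin0 add0r.
by rewrite IH binS natrD addrC.
Qed.

Lemma monicX1 : ('X + 1 : {poly K}) \is monic.
Proof. by have := monicXaddC (1 : K). Qed.

Lemma size_X1_exp c : size (('X + 1 : {poly K}) ^+ c) = c.+1.
Proof.
have -> : 'X + 1 = 'X - (-1)%:P :> {poly K} by rewrite polyCN opprK.
by rewrite size_exp_XsubC.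
Qed.

Lemma size_X1_exp_mul c P : P != 0 -> size (('X + 1) ^+ c * P) = (c + size P)%N.
Proof. by move=> P0; rewrite size_monicM ?monic_exp ?monicX1 // size_X1_exp. Qed.

Lemma zero_in_box_X1 P a b d c : zero_in_box P a b d ->
  zero_in_box (('X + 1) ^+ c * P) a b (d + c).
Proof.
move=> vP; elim: c => [|c IH]; first by rewrite mul1r addn0.
rewrite exprS -mulrA addnS => w lt_wa lt_dw; rewrite coef_X1_mul.
rewrite IH ?addr0 //; last lia.
by case: w lt_wa lt_dw => // w lt_wa lt_dw; rewrite IH //; lia.
Qed.

Lemma X1_exp_mul_low c P a :
  (forall w, (w < a)%N -> (('X + 1) ^+ c * P)`_w = 0) ->
  forall w, (w < a)%N -> P`_w = 0.
Proof.
elim: c => [|c IH]; first by rewrite mul1r.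
rewrite exprS -mulrA => H; apply: IH => w; elim: w => [|w IHw] lt_wa.
  by have := H 0%N lt_wa; rewrite coef_X1_mul add0r.
by have := H _ lt_wa; rewrite coef_X1_mul IHw ?add0r // ltnW.
Qed.

(** Multiplying by the complementary power replaces [('X + 1)^Q] by ['X^Q + 1]; for
    degree reasons [f] is then a multiple of [('X + 1)^(Q - c)], a polynomial of larger
    degree than [f]. *)
Lemma X1_exp_pchar_inj (p E : nat) (a b j c : nat) f : p \in [pchar K] ->
  let Q := (p ^ E)%N in
  (a <= Q)%N -> (b <= Q)%N -> (Q + j < a + b)%N -> (j + c < Q)%N -> (size f <= j.+1)%N ->
  zero_in_box (('X + 1) ^+ c * f) a b (j + c) -> f = 0.
Proof.
move=> pK Q le_aQ le_bQ lt_Qab lt_jcQ sf vG; set G := _ * f in vG.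
have frob : ('X + 1 : {poly K}) ^+ Q = 'X^Q + 1.
  rewrite exprDn_pchar ?expr1n // pnatX pnatE ?(pcharf_prime pK) //.
  by rewrite pchar_poly pK.
(* modulo ['X^a] only the part of [G] of low degree is left, which is a multiple of [z^b] *)
pose V := take_poly a G.
have sV : (size V <= j + c + 1 - b)%N.
  apply/leq_sizeP => w le_w; rewrite coef_take_poly; case: ifP => // lt_wa.
  by apply: vG; lia.
have eqV : ('X + 1) ^+ (Q - c) * V = f.
  have E1 : ('X + 1) ^+ (Q - c) * V + ('X + 1) ^+ (Q - c) * drop_poly a G * 'X^a
     = 'X^Q * f + f.
    rewrite -mulrA -mulrDr poly_take_drop mulrA -exprD subnK ?frob ?mulrDl ?mul1r //.
    by lia.
  apply/polyP => w; case: (ltnP w a) => [lt_wa | le_aw].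
    have := congr1 (fun P : {poly K} => P`_w) E1.
    by rewrite /= !coefD coefMXn lt_wa addr0 coefXnM (leq_trans lt_wa le_aQ) add0r.
  rewrite [RHS]nth_default; last by apply: leq_trans sf _; lia.
  case: (eqVneq V 0) => [-> | V0]; first by rewrite mulr0 coef0.
  by rewrite nth_default // size_X1_exp_mul //; move: V0; rewrite -size_poly_gt0; lia.
case: (eqVneq V 0) => [V0 | V0]; first by rewrite -eqV V0 mulr0.
exfalso; move: V0 (V0) sf; rewrite -{1}size_poly_gt0 => sV0 V0.
by rewrite -eqV size_X1_exp_mul //; lia.
Qed.

Lemma X1_exp_det_inj (j u v : nat) f :
  \det (binmx K j.+1 u (u + v)) != 0 -> (size f <= j.+1)%N ->
  zero_in_box (('X + 1) ^+ (u + v) * f) (u + j.+1) (v + j.+1) (j + (u + v)) -> f = 0.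
Proof.
move=> D0 sf vG; set B := binmx _ _ _ _ in D0.
have uB : B \in unitmx by rewrite unitmxE unitfE.
have E : B *m (\col_(i < j.+1) f`_i) = 0.
  apply/matrixP=> i o; rewrite !mxE; have lt_ij := ltn_ord i.
  apply: etrans (vG (u + i)%N _ _); [ | by rewrite ltn_add2l | lia].
  rewrite coefMr; under eq_bigr => l _ do rewrite !mxE.
  pose F l := (if (l <= u + i)%N then 'C(u + v, u + i - l) else 0%N)%:R * f`_l.
  have widen n N : (n <= N)%N -> (forall l, (n <= l)%N -> F l = 0) ->
      \sum_(l < n) F l = \sum_(l < N) F l.
    move=> le_nN F0; rewrite (big_ord_widen N F le_nN) big_mkcond /=.
    by apply: eq_bigr => l _; case: ltnP => // /F0.
  transitivity (\sum_(l < maxn (u + i).+1 j.+1) F l).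
    rewrite -(widen j.+1) ?leq_maxr // => l le_l.
    by rewrite /F (nth_default 0 (leq_trans sf le_l)) mulr0.
  rewrite -(widen (u + i).+1) ?leq_maxl //.
    by apply: eq_bigr => l _; rewrite /F -ltnS ltn_ord coef_X1_exp.
  by move=> l le_l; rewrite /F leqNgt le_l mul0r.
apply/polyP => w; rewrite coef0; case: (ltnP w j.+1) => [lt_w | le_w].
  have := congr1 (fun A => (invmx B *m A) (Ordinal lt_w) 0) E.
  by rewrite /= mulKmx // mulmx0 !mxE.
by rewrite nth_default // (leq_trans sf).
Qed.

(** Only the case where source and target are mirror images of each other needs the
    determinant: a smaller power divides the power that does reach the mirror image,
    and when the latter would reach degree [Q], [X1_exp_pchar_inj] applies. *)
Lemma powers_injective_of_det (p E a b : nat) : p \in [pchar K] ->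
  let Q := (p ^ E)%N in (a <= Q)%N -> (b <= Q)%N ->
  (forall m u v, (m + u = a)%N -> (m + v = b)%N -> (m + u + v <= Q)%N ->
    \det (binmx K m u (u + v)) != 0) ->
  powers_injective Q a b 0.
Proof.
move=> pK Q le_aQ le_bQ D j c f sf le_jc lt_jcQ vG.
case: (leqP a j) => [le_aj | lt_ja].
  move=> w lt_wa lt_jw; apply: X1_exp_mul_low lt_wa => w' lt_w'.
  by apply: vG => //; lia.
case: (leqP b j) => [le_bj | lt_jb].
  case: (eqVneq f 0) => [-> | f0] w lt_wa lt_jw; first by rewrite coef0.
  apply: nth_default; suff : (size (('X + 1) ^+ c * f)%R <= j + c + 1 - b)%N.
    by rewrite size_X1_exp_mul //; move: (size f) => n; lia.
  apply/leq_sizeP => w' le_w'; case: (ltnP w' a) => [lt_w' | le_w'a].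
    by apply: vG => //; lia.
  by apply: nth_default; rewrite size_X1_exp_mul //; lia.
suff -> : f = 0 by move=> w _ _; rewrite coef0.
case: (ltnP (a + b - 2 - j) Q) => [lt_Q | le_Q]; last first.
  by apply: X1_exp_pchar_inj le_aQ le_bQ _ lt_jcQ sf vG => //; lia.
pose u := (a - j.+1)%N; pose v := (b - j.+1)%N.
apply: (@X1_exp_det_inj j u v) => //; first by apply: D; rewrite /u /v; lia.
have -> : (u + v = (u + v - c) + c)%N by rewrite /u /v; lia.
rewrite exprD -mulrA [(_ - _ + _)%N]addnC addnA.
by rewrite /u /v !subnK //; apply: zero_in_box_X1.
Qed.

(** Multiplication by [x] embeds [K[x, z] / (x^a, z^b)] in the algebra with exponents
    [a + 1] and [b]. *)
Lemma powers_injective_up (p E a b : nat) : p \in [pchar K] ->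
  let Q := (p ^ E)%N in (a < Q)%N -> (b <= Q)%N ->
  powers_injective Q a.+1 b 0 -> powers_injective Q a b 1.
Proof.
move=> pK Q lt_aQ le_bQ nk j c f sf le_jc lt_jcQ vG.
case: (leqP Q (j + c).+1) => [le_Q | lt_Q].
  suff -> : f = 0 by move=> w _ _; rewrite coef0.
  by apply: X1_exp_pchar_inj (ltnW lt_aQ) le_bQ _ lt_jcQ sf vG => //; rewrite -/Q; lia.
move=> w lt_wa lt_jw; have := nk j.+1 c ('X * f) _ _ _ _ w.+1.
rewrite coefXM /=; apply=> //; try lia.
  by apply: leq_trans (size_polyMleq _ _) _; rewrite size_polyX.
rewrite mulrCA => - [|w'] lt_w' lt_jw'; rewrite coefXM //=.
by apply: vG; lia.
Qed.

(** The kernel of the projection to the algebra with exponents [a] and [b] consists of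
    multiples of [x^a], on which [x + z] acts as [z]. *)
Lemma powers_injective_down (Q a b : nat) :
  powers_injective Q a b 0 -> powers_injective Q a.+1 b 1.
Proof.
move=> nk j c f sf le_jc lt_jcQ vG.
have vf : zero_in_box f a b j.
  apply: (nk j c) => //; first lia.
  by move=> w lt_w lt_jw; apply: vG => //; lia.
move=> w lt_wa lt_jw; case: (ltnP w a) => [lt_w | le_w]; first exact: vf.
have {lt_wa le_w} wE : w = a by lia.
subst w; apply: etrans (vG a _ _) => //; last lia.
rewrite coefMr big_ord_recr /= subnn coef_X1_exp bin0 mul1r big1 ?add0r // => i _.
have lt_ia := ltn_ord i; rewrite coef_X1_exp.
case: (ltnP j (i + b)) => [lt_ji | le_ij]; first by rewrite vf ?mulr0.
by rewrite bin_small ?mul0r //; lia.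
Qed.

Lemma powers_injective_central (p e a b : nat) : p \in [pchar K] ->
  (a <= p ^ e.+1)%N -> (b <= p ^ e.+1)%N ->
  (forall i, (1 <= i <= e)%N -> central (p ^ i) a b) ->
  powers_injective (p ^ e.+1) a b 0.
Proof.
move=> pK le_a le_b cen; apply: powers_injective_of_det => // m u v aE bE le_Q.
apply: (det_binmx_neq0 pK).
have := @logn_fact_central p e a b m (pcharf_prime pK) cen.
have -> : (a - m = u)%N by lia.
have -> : (b - m = v)%N by lia.
by apply; lia.
Qed.

End Strings.

(** * From two variables to four *)

Section FourVariables.
Local Open Scope ring_scope.
Variable K : fieldType.
Implicit Types (g h : nat -> nat -> K) (f : nat -> nat -> nat -> nat -> K).

(** Multiplication by [a * x + b * z] on polynomials in [x, z], given by their
    coefficients. *)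
Definition mul2 (a b : K) g : nat -> nat -> K := fun u v =>
  a * (if u is u'.+1 then g u' v else 0) + b * (if v is v'.+1 then g u v' else 0).

Definition mul12 (a b : K) f : nat -> nat -> nat -> nat -> K :=
  fun x y z w => mul2 a b (fun u v => f u v z w) x y.

Definition mul34 (a b : K) f : nat -> nat -> nat -> nat -> K :=
  fun x y => mul2 a b (f x y).

(** The part of degree [j], at [z = 1]. *)
Definition dehom (j : nat) g : {poly K} := \poly_(w < j.+1) g w (j - w)%N.

Lemma size_dehom j g : (size (dehom j g) <= j.+1)%N.
Proof. exact: size_poly. Qed.

Lemma size_lin_exp_mul (a b : K) c n (P : {poly K}) : (size P <= n)%N ->
  (size ((a *: 'X + b%:P) ^+ c * P)%R <= c + n)%N.
Proof.
move=> sP; elim: c => [|c IH]; first by rewrite mul1r.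
rewrite exprS -mulrA; apply: leq_trans (size_polyMleq _ _) _.
have : (size (a *: 'X + b%:P)%R <= 2)%N.
  apply: leq_trans (size_polyD _ _) _; rewrite geq_max.
  rewrite (leq_trans (size_scale_leq _ _)) ?size_polyX //=.
  by rewrite (leq_trans (size_polyC_leq1 _)).
move: IH; set s := size _; set s' := size _; lia.
Qed.

Lemma coef_lin_mul (a b : K) (P : {poly K}) u :
  ((a *: 'X + b%:P) * P)`_u = a * (if u is u'.+1 then P`_u' else 0) + b * P`_u.
Proof. by rewrite mulrDl -scalerAl coefD coefZ coefXM coefCM; case: u. Qed.

Lemma iter_mul2E (a b : K) g j c u v : (u + v = j + c)%N ->
  iter c (mul2 a b) g u v = ((a *: 'X + b%:P) ^+ c * dehom j g)`_u.
Proof.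
elim: c u v => [|c IH] u v uv.
  rewrite mul1r coef_poly ifT /=; last lia.
  by have -> : v = (j - u)%N by lia.
rewrite iterS exprS -mulrA coef_lin_mul /mul2; congr (_ * _ + _ * _).
  by case: u uv => // u uv; rewrite IH //; lia.
case: v uv => [|v] uv; last by rewrite IH //; lia.
rewrite nth_default //; apply: leq_trans (size_lin_exp_mul _ _ _ (size_dehom _ _)) _.
lia.
Qed.

Lemma iter_mul2_low (a b : K) g c u v : (u + v < c)%N ->
  iter c (mul2 a b) g u v = 0.
Proof.
elim: c u v => // c IH u v lt_c; rewrite iterS /mul2.
case: u lt_c => [|u] lt_c; rewrite ?IH ?mulr0 ?add0r //; try lia;
  by case: v lt_c => [|v] lt_c; rewrite ?IH ?mulr0 //; lia.
Qed.

Lemma iter_mul2_eq0 (a b : K) (m n : nat) g j c u v :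
  (forall u v, (u < m)%N -> (v < n)%N -> (u + v = j)%N -> g u v = 0) ->
  (u < m)%N -> (v < n)%N -> (u + v = j + c)%N -> iter c (mul2 a b) g u v = 0.
Proof.
move=> g0; elim: c u v => [|c IH] u v lt_um lt_vn uv.
  by apply: g0 => //; lia.
rewrite iterS /mul2.
have -> : (if u is u'.+1 then iter c (mul2 a b) g u' v else 0) = 0.
  by case: u lt_um uv => // u lt_um uv; rewrite IH //; lia.
have -> : (if v is v'.+1 then iter c (mul2 a b) g u v' else 0) = 0.
  by case: v lt_vn uv => // v lt_vn uv; rewrite IH //; lia.
by rewrite !mulr0 addr0.
Qed.

Lemma powers_injective_mul2 (Q m n t : nat) (s : K) g j c :
  powers_injective K Q m n t -> s != 0 ->
  (2 * j + c + 2 + t <= m + n)%N -> (j + c < Q)%N ->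
  (forall u v, (u < m)%N -> (v < n)%N -> (u + v = j + c)%N ->
     iter c (mul2 s s) g u v = 0) ->
  forall u v, (u < m)%N -> (v < n)%N -> (u + v = j)%N -> g u v = 0.
Proof.
move=> nk s0 le_jc lt_jcQ ker u v lt_um lt_vn uv.
have := nk j c (dehom j g) (size_dehom _ _) le_jc lt_jcQ.
move=> /(_ _ u lt_um); rewrite coef_poly ifT; last lia.
have -> : (j - u = v)%N by lia.
apply; last lia.
move=> w lt_wm lt_w; case: (leqP w (j + c)) => [le_w | lt_w'].
  have := ker w (j + c - w)%N lt_wm; rewrite (@iter_mul2E _ _ _ j); last lia.
  have -> : s *: 'X + s%:P = s *: ('X + 1) :> {poly K}.
    by rewrite scalerDr -alg_polyC.
  rewrite exprZn -scalerAl coefZ => /(_ _ _) E; apply/eqP.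
  have /eqP : s ^+ c * (('X + 1) ^+ c * dehom j g)`_w = 0 by apply: E; lia.
  by rewrite mulf_eq0 expf_eq0 (negPf s0) andbF.
have := size_lin_exp_mul 1 1 c (size_dehom j g); rewrite scale1r => sz.
by apply: nth_default; apply: leq_trans sz _; lia.
Qed.

Lemma iter_mul12E (a b : K) f c x y z w :
  iter c (mul12 a b) f x y z w = iter c (mul2 a b) (fun u v => f u v z w) x y.
Proof. by elim: c x y => // c IH [|x] [|y]; rewrite !iterS /mul12 /mul2 ?IH. Qed.

Lemma iter_mul34E (a b : K) f c x y z w :
  iter c (mul34 a b) f x y z w = iter c (mul2 a b) (f x y) z w.
Proof. by elim: c z w => // c IH [|z] [|w]; rewrite !iterS /mul34 /mul2 ?IH. Qed.

Lemma mul12_mul34C (a b a' b' : K) f x y z w :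
  mul12 a b (mul34 a' b' f) x y z w = mul34 a' b' (mul12 a b f) x y z w.
Proof. by rewrite /mul12 /mul34 /mul2; case: x y z w => [|x] [|y] [|z] [|w]; ring. Qed.

Section Box.
Variables d1 d2 d3 d4 : nat.

Definition eq_on_box (n : nat) (f1 f2 : nat -> nat -> nat -> nat -> K) : Prop :=
  forall x y z w, (x < d1)%N -> (y < d2)%N -> (z < d3)%N -> (w < d4)%N ->
    (x + y + z + w = n)%N -> f1 x y z w = f2 x y z w.

Lemma eq_mul12 a b n f1 f2 : eq_on_box n f1 f2 ->
  eq_on_box n.+1 (mul12 a b f1) (mul12 a b f2).
Proof.
move=> E x y z w lt_x lt_y lt_z lt_w sum; rewrite /mul12 /mul2; congr (_ * _ + _ * _).
  by case: x lt_x sum => // x lt_x sum; apply: E => //; lia.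
by case: y lt_y sum => // y lt_y sum; apply: E => //; lia.
Qed.

Lemma eq_mul34 a b n f1 f2 : eq_on_box n f1 f2 ->
  eq_on_box n.+1 (mul34 a b f1) (mul34 a b f2).
Proof.
move=> E x y z w lt_x lt_y lt_z lt_w sum; rewrite /mul34 /mul2; congr (_ * _ + _ * _).
  by case: z lt_z sum => // z lt_z sum; apply: E => //; lia.
by case: w lt_w sum => // w lt_w sum; apply: E => //; lia.
Qed.

(** The two multiplications commute, so that agreeing once means agreeing forever. *)
Lemma eq_iter_mul12_mul34 a b a' b' i c f :
  eq_on_box i.+1 (mul12 a b f) (mul34 a' b' f) ->
  eq_on_box (i + c) (iter c (mul12 a b) f) (iter c (mul34 a' b') f).
Proof.
move=> ker.
have comm k : eq_on_box (i + k).+1 (mul12 a b (iter k (mul34 a' b') f))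
    (iter k (mul34 a' b') (mul12 a b f)).
  elim: k => [|k IH]; first by move=> *.
  move=> x y z w hx hy hz hw; rewrite !iterS mul12_mul34C addnS => sum.
  exact: (eq_mul34 _ _ IH).
have push k : eq_on_box (i + k).+1 (iter k (mul34 a' b') (mul12 a b f))
    (iter k (mul34 a' b') (mul34 a' b' f)).
  elim: k => [|k IH]; first by rewrite addn0.
  by rewrite addnS; apply: eq_mul34.
elim: c => [|c IH]; first by rewrite addn0.
move=> x y z w hx hy hz hw; rewrite addnS iterS => sum.
rewrite (eq_mul12 _ _ IH) // comm // push //.
by rewrite iterSr.
Qed.

(** Induction on the degree [j] of a component in the first two variables, with [n]
    the complementary degree.  Lower components being zero, the power [c + 1] of
    [x3 + x4] kills the component of degree [j + c], which is therefore zero; hence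
    the power [c] of [x1 + x2] kills the component of degree [j].  The degree of [f]
    is low enough for some [c] to make both powers injective. *)
Lemma pair_injective (Q t i : nat) f :
  powers_injective K Q d1 d2 t -> powers_injective K Q d3 d4 0 ->
  (2 * i + 5 + t <= d1 + d2 + d3 + d4)%N -> (d1 + d2 + d3 + d4 <= 2 * Q + 2)%N ->
  eq_on_box i.+1 (mul12 1 1 f) (mul34 (-1) (-1) f) ->
  eq_on_box i f (fun _ _ _ _ => 0).
Proof.
move=> injM injN le_i le_Q ker.
have N1 : (-1 : K) != 0 by rewrite oppr_eq0 oner_eq0.
suff H j x y z w : (x < d1)%N -> (y < d2)%N -> (z < d3)%N -> (w < d4)%N ->
    (x + y = j)%N -> (x + y + z + w = i)%N -> f x y z w = 0.
  by move=> x y z w *; apply: H.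
elim/ltn_ind: j x y z w => j IH x y z w hx hy hz hw xy sum.
(* the least [c] for which the second power is injective on the complementary degree *)
pose n := (i - j)%N; pose c := (2 * n + 3 - (d3 + d4))%N.
have zwn : (z + w = n)%N by rewrite /n; lia.
have kerc k := @eq_iter_mul12_mul34 1 1 (-1) (-1) i k f ker.
have fB u v z' w' : (u < d1)%N -> (v < d2)%N -> (z' < d3)%N -> (w' < d4)%N ->
    (u + v = j + c)%N -> (z' + w' + c = n)%N -> f u v z' w' = 0.
  move=> hu hv hz' hw' uv zw'.
  apply: (@powers_injective_mul2 Q d3 d4 0 (-1) (f u v) (n - c) c.+1) => //; try lia.
    move=> z1 w1 hz1 hw1 zw1; rewrite -iter_mul34E -kerc //; last by rewrite /n; lia.
    rewrite iter_mul12E.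
    case: j IH xy {kerc} @n c zwn uv zw' zw1 => [|j] IH xy n c zwn uv zw' zw1.
      by apply: iter_mul2_low; lia.
    apply: (@iter_mul2_eq0 1 1 d1 d2 _ j) => //; last lia.
    by move=> u1 v1 hu1 hv1 uv1; apply: (IH j) => //; lia.
case: (posnP c) => [c0 | c_gt0]; first by apply: fB => //; lia.
apply: (@powers_injective_mul2 Q d1 d2 t 1 (fun u v => f u v z w) j c) => //; try lia.
  by rewrite oner_eq0.
move=> u v hu hv uv; rewrite -iter_mul12E kerc //; last lia.
rewrite iter_mul34E; case: (ltnP n c) => [lt_nc | le_cn].
  by apply: iter_mul2_low; lia.
apply: (@iter_mul2_eq0 _ _ d3 d4 _ (n - c)) => //; last lia.
by move=> z1 w1 hz1 hw1 zw1; apply: fB => //; lia.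
Qed.

End Box.
End FourVariables.

(** * The weak Lefschetz property below the middle degree *)

Section Ideal.
Local Open Scope ring_scope.
Variables (K : fieldType) (n : nat) (d : 'I_n -> nat).
Implicit Types (f g : {mpoly K[n]}) (m : 'X_{1..n}).

Definition in_box m : bool := [forall i, m i < d i]%N.

Lemma mcoeffMXE f k m :
  (f * 'X_[k])@_m = if (k <= m)%MM then f@_(m - k) else 0.
Proof.
case: ifP => [le_km | nle_km].
  by rewrite -{1}(submK le_km) addmC mcoeffMX.
apply/eqP; rewrite mcoeff_eq0 (perm_mem (msuppMX _ _)).
by apply/mapP => -[m' _ mE]; rewrite mE lem_addr in nle_km.
Qed.

(** A monomial ideal is spanned by monomials. *)
Lemma power_idealP f :
  reflect (forall m, in_box m -> f@_m = 0) (f \in power_ideal d).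
Proof.
have XE i : 'X_i ^+ d i = 'X_[U_(i) *+ d i] :> {mpoly K[n]} by rewrite mpolyXn.
apply: (iffP idP) => [/asboolP [c ->] m /forallP box_m | f0].
  rewrite raddf_sum /= big1 // => i _; rewrite XE mcoeffMXE ifF //.
  apply/negP => /mnm_lepP /(_ i); rewrite mulmnE mnm1E eqxx mul1n.
  by rewrite leqNgt box_m.
apply/asboolP.
pose E i m := [pick j | (d j <= m j)%N] == Some i.
exists (fun i => \sum_(m <- msupp f | E i m) f@_m *: 'X_[m - U_(i) *+ d i]).
have term i m : E i m -> 'X_[m - U_(i) *+ d i] * 'X_i ^+ d i = 'X_[m] :> {mpoly K[n]}.
  rewrite /E; case: pickP => // j le_j /eqP [<-].
  rewrite XE -mpolyXD submK //; apply/mnm_lepP => l; rewrite mulmnE mnm1E.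
  by case: eqP => [<-|_]; rewrite ?mul1n ?mul0n.
transitivity (\sum_i \sum_(m <- msupp f | E i m) f@_m *: 'X_[m]); last first.
  apply: eq_bigr => i _; rewrite mulr_suml; apply: eq_bigr => m Em.
  by rewrite -scalerAl term.
rewrite (exchange_big_dep xpredT) //= {1}(mpolyE f); apply: eq_big_seq => m m_f.
rewrite /E; case: pickP => [j le_j | none].
  by rewrite (big_pred1 j) // => i; rewrite eq_sym.
suff fm0 : f@_m = 0 by rewrite mcoeff_msupp fm0 eqxx in m_f.
apply/f0/forallP => i; by have := none i; rewrite leqNgt => /negbFE.
Qed.

Lemma mcoeff_lin_mul (a : 'I_n -> K) f m :
  ((\sum_i a i *: 'X_i) * f)@_m =
  \sum_i a i * (if (0 < m i)%N then f@_(m - U_(i)) else 0).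
Proof.
rewrite mulr_suml raddf_sum /=; apply: eq_bigr => i _.
rewrite -scalerAl mcoeffZ mulrC [X in X@__]mulrC mcoeffMXE [LHS]mulrC.
congr (_ * _); case: ifP => [/mnm_lepP /(_ i) | /negP nle].
  by rewrite mnm1E eqxx => ->.
case: posnP => // mi_gt0; case: nle; apply/mnm_lepP => j; rewrite mnm1E.
by case: eqP => // <-.
Qed.

Lemma homog1_lin f : f \is 1.-homog -> f = \sum_i f@_(U_(i)) *: 'X_i.
Proof.
move=> hf; apply/mpolyP => m; rewrite raddf_sum /=.
under eq_bigr => i _ do rewrite mcoeffZ mcoeffX.
case: (mdeg1P m) => [[i /eqP ->] | not1].
  rewrite (bigD1 i) //= eqxx mulr1 big1 ?addr0 // => j ne_ji.
  rewrite (_ : (U_(j)%MM == U_(i)%MM) = false) ?mulr0 //.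
  apply/negbTE/eqP => /mnmP /(_ i); rewrite !mnm1E eqxx.
  by rewrite (negPf ne_ji).
rewrite (dhomog_nemf_coeff hf) ?big1 //; last by apply/negP => /mdeg1P.
by move=> i _; case: eqP => [E|_]; [case: not1; exists i; rewrite E | rewrite mulr0].
Qed.

Lemma lin_homog (a : 'I_n -> K) : \sum_i a i *: 'X_i \is 1.-homog.
Proof. by apply: rpred_sum => i _; apply: rpredZ; rewrite dhomogX /= mdeg1. Qed.

Lemma subm_subK m1 m2 : (m1 <= m2)%MM -> (m2 - (m2 - m1))%MM = m1.
Proof.
move/mnm_lepP => le_m; apply/mnmP => i; rewrite !mnmBE.
by have := le_m i; lia.
Qed.

Lemma submonomial m k : (k <= mdeg m)%N -> exists2 m1, (m1 <= m)%MM & mdeg m1 = k.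
Proof.
elim: k => [|k IH] le_k.
  by exists 0%MM; [apply/mnm_lepP => i; rewrite mnm0E | rewrite mdeg0].
have [m1 le_m1 deg_m1] := IH (ltnW le_k).
have deg_sub : mdeg (m - m1)%MM = (mdeg m - k)%N.
  by rewrite -deg_m1 -{2}(submK le_m1) mdegD addnK.
have /existsP [i ne_i] : [exists i, (m - m1)%MM i != 0%N].
  rewrite -negb_forall; apply/negP => /forallP H.
  have : mdeg (m - m1)%MM = 0%N by rewrite mdegE big1 // => i _; apply/eqP.
  by rewrite deg_sub; lia.
exists (m1 + U_(i))%MM; last by rewrite mdegD mdeg1 deg_m1 addn1.
apply/mnm_lepP => j; rewrite mnmDE mnm1E; move/mnm_lepP: le_m1 => /(_ j).
by case: eqP => [ij|_]; rewrite ?addn0 //; move: ne_i; rewrite ij mnmBE; lia.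
Qed.

End Ideal.

(** A linear system is solvable as soon as its right hand side is orthogonal to the
    kernel of the transposed matrix. *)
Lemma fredholm (K : fieldType) (I J : finType) (A : I -> J -> K) (g : J -> K) :
  (forall phi : J -> K, (forall i, \sum_j A i j * phi j = 0)%R ->
     \sum_j g j * phi j = 0)%R ->
  exists f : I -> K, forall j, (\sum_i f i * A i j)%R = g j.
Proof.
move=> orth.
pose M := (\matrix_(i < #|I|, j < #|J|) A (enum_val i) (enum_val j))%R.
pose v := (\row_(j < #|J|) g (enum_val j))%R.
have sumE (T : finType) (F : T -> K) : (\sum_t F t = \sum_(k < #|T|) F (enum_val k))%R.
  by rewrite (reindex_onto (fun k => enum_val k) enum_rank) /=;
    [apply: eq_bigl => k; rewrite enum_valK eqxx | move=> t _; rewrite enum_rankK].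
have : (v <= M)%MS.
  rewrite submxE; apply/eqP/matrixP => o c; rewrite !mxE.
  have := orth (fun j => cokermx M (enum_rank j) c).
  rewrite sumE => /(_ _) E; rewrite -[RHS]E => [|i].
    by apply: eq_bigr => k _; rewrite !mxE enum_valK.
  rewrite sumE; have := congr1 (fun B : 'M_(_, _) => B (enum_rank i) c) (mulmx_coker M).
  rewrite /= !mxE => H; rewrite -[RHS]H; apply: eq_bigr => k _.
  by rewrite !mxE enum_rankK enum_valK.
case/submxP => f vE; exists (fun i => f ord0 (enum_rank i)) => j.
have := congr1 (fun B : 'M_(_, _) => B ord0 (enum_rank j)) vE.
rewrite /= !mxE enum_rankK => ->; rewrite sumE; apply: eq_bigr => k _.
by rewrite !mxE enum_rankK enum_valK.
Qed.

Section Lefschetz.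
Local Open Scope ring_scope.
Variables (K : fieldType) (n : nat) (d : 'I_n -> nat) (d_gt0 : forall i, (0 < d i)%N).
Implicit Types (f g : {mpoly K[n]}) (m : 'X_{1..n}).

Let I := power_ideal (K := K) d.
Let A := monomial_ci K d_gt0.
Notation "\pic f" := (\pi_A%qT f : A) (at level 10, f at next level).

Definition socle_degree : nat := (\sum_i (d i).-1)%N.

Lemma pi_eqP f g : reflect (\pic f = \pic g) (f - g \in I).
Proof.
have -> : (f - g \in I) = (f - g \in power_idealr K d_gt0) by [].
by rewrite Quotient.idealrBE; apply: eqP.
Qed.

Lemma ideal_mull f g : g \in I -> f * g \in I.
Proof. exact: (@idealMr _ (power_idealr K d_gt0)). Qed.

Lemma ideal_sub f g : f \in I -> g \in I -> f - g \in I.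
Proof. by move=> If Ig; exact: (@rpredB _ (power_idealr K d_gt0)). Qed.

Definition below_middle_injective (l : {mpoly K[n]}) : Prop :=
  forall i f, (2 * i < socle_degree)%N -> f \is i.-homog -> l * f \in I -> f \in I.

(** It spans the socle. *)
Definition top_monomial : 'X_{1..n} := [multinom (d i).-1 | i < n].

Lemma mdeg_top : mdeg top_monomial = socle_degree.
Proof. by rewrite mdegE; apply: eq_bigr => i _; rewrite mnmE. Qed.

Lemma in_boxE m : in_box d m = (m <= top_monomial)%MM.
Proof.
apply/forallP/mnm_lepP => H i; have := H i; rewrite mnmE; have := d_gt0 i; lia.
Qed.

(** Suppose that [l] is surjective from degree [i] and that [l * f] is zero.  As
    [2 * i < s], every monomial of degree [s - i] has a factor of degree [i + 1], which
    is a multiple of [l] modulo the ideal; so [f] annihilates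
    the whole degree [s - i], which is dual to its own degree. *)
Lemma weak_Lefschetz_injective : weak_Lefschetz (@monomial_ci_deg K n d d_gt0) ->
  exists2 l, l \is 1.-homog & below_middle_injective l.
Proof.
case=> _ [l hl ->] max_rank; exists l => // i f lt_i hf lfI.
apply/power_idealP => m box_m; apply/eqP.
case: (eqVneq (mdeg m) i) => [deg_m | ne_deg]; last by rewrite (dhomog_nemf_coeff hf).
case: (max_rank i) => [inj | surj].
  have : \pic f = \pic 0.
    apply: inj; [by exists f | by exists 0; rewrite ?dhomog0 | ].
    by rewrite -!rmorphM mulr0 /=; apply/pi_eqP; rewrite subr0.
  by move/pi_eqP; rewrite subr0 => /power_idealP ->.
move: (box_m); rewrite in_boxE => le_m.
set M := (top_monomial - m)%MM.
have deg_M : mdeg M = (socle_degree - i)%N.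
  by rewrite -deg_m -mdeg_top -(submK le_m) mdegD addnK.
have [m1 le_m1 deg_m1] : exists2 m1, (m1 <= M)%MM & mdeg m1 = i.+1.
  by apply: submonomial; rewrite deg_M; lia.
have [_ [h hh ->]] : exists2 a : A, monomial_ci_deg i a & \pic l * a = \pic 'X_[m1].
  by apply: surj; exists 'X_[m1] => //; rewrite dhomogX /= deg_m1.
rewrite -rmorphM => /pi_eqP hI.
have : f * 'X_[M] \in I.
  have -> : f * 'X_[M] = 'X_[M - m1] * h * (l * f) - 'X_[M - m1] * f * (l * h - 'X_[m1]).
    rewrite -{1}(submK le_m1) mpolyXD; ring.
  by apply: ideal_sub; apply: ideal_mull.
move/power_idealP => /(_ top_monomial); rewrite in_boxE lepm_refl => /(_ isT).
by rewrite mcoeffMXE lem_subr /M subm_subK // => ->.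
Qed.

(** Complementing monomials in the socle monomial identifies the transpose of the
    multiplication by [l] on degree [i] with the multiplication by [l] on degree
    [s - i - 1]. *)
Lemma injective_weak_Lefschetz (a : 'I_n -> K) :
  below_middle_injective (\sum_i a i *: 'X_i) ->
  weak_Lefschetz (@monomial_ci_deg K n d d_gt0).
Proof.
have hl := lin_homog a; move: hl; set l : {mpoly K[n]} := \sum_i _ => hl inj.
exists (\pic l); first by exists l.
move=> i; case: (ltnP (2 * i) socle_degree) => [lt_i | le_i].
  left=> _ _ [f hf ->] [g hg ->]; rewrite -!rmorphM => /pi_eqP; rewrite -mulrBr => lfI.
  by apply/pi_eqP; apply: inj lt_i _ lfI; rewrite rpredB.
right=> _ [g hg ->].
(* the matrix of [l] from degree [i] to degree [i + 1] *)
pose A' (m m' : 'X_{1..n < i.+2}) : K :=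
  if [&& in_box d m', mdeg m' == i.+1 & mdeg m == i] then (l * 'X_[m])@_m' else 0.
pose g' (m' : 'X_{1..n < i.+2}) : K := if in_box d m' then g@_m' else 0.
have dual m m' : in_box d m -> in_box d m' ->
    (l * 'X_[top_monomial - m'])@_(top_monomial - m) = (l * 'X_[m])@_m'.
  rewrite !in_boxE => /mnm_lepP le_m /mnm_lepP le_m'; rewrite !mulr_suml !raddf_sum /=.
  apply: eq_bigr => k _; rewrite -!scalerAl !mcoeffZ -!mpolyXD !mcoeffX; congr (_ * _%:R).
  congr nat_of_bool; apply/eqP/eqP => /mnmP E; apply/mnmP => j; have := E j;
    rewrite !mnmDE !mnmBE; have := le_m j; have := le_m' j; lia.
have [phi phi_dual | f fE] := @fredholm K _ _ A' g'.
  suff phi0 (m' : 'X_{1..n < i.+2}) : in_box d m' -> mdeg m' = i.+1 -> phi m' = 0.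
    apply: big1 => m' _; rewrite /g'; case: ifP => box_m'; last by rewrite mul0r.
    case: (eqVneq (mdeg m') i.+1) => [deg_m' | ne]; first by rewrite phi0 ?mulr0.
    by rewrite (dhomog_nemf_coeff hg) ?mul0r.
  move=> box_m' deg_m'.
  pose P (m' : 'X_{1..n < i.+2}) := in_box d m' && (mdeg m' == i.+1).
  pose F : {mpoly K[n]} := \sum_(m' | P m') phi m' *: 'X_[top_monomial - m'].
  have deg_sub m1 : in_box d m1 -> mdeg (top_monomial - m1)%MM = (socle_degree - mdeg m1)%N.
    by rewrite in_boxE => le_m1; rewrite -mdeg_top -{2}(submK le_m1) mdegD addnK.
  have le_deg : (i.+1 <= socle_degree)%N.
    rewrite -deg_m' -mdeg_top; move: box_m'; rewrite in_boxE => /submK <-.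
    by rewrite mdegD leq_addl.
  have hF : F \is (socle_degree - i.+1).-homog.
    apply: rpred_sum => m1 /andP[box_m1 /eqP deg_m1]; apply: rpredZ.
    by rewrite dhomogX /= deg_sub // deg_m1.
  have lF : l * F \in I.
    apply/power_idealP => m2 box_m2; case: (eqVneq (mdeg m2) (socle_degree - i)%N); last first.
      move=> ne; apply: (@dhomog_nemf_coeff _ _ _ (1 + (socle_degree - i.+1))%N).
        exact: dhomogM hl hF.
      by apply: contraNneq ne => ->; apply/eqP; lia.
    move=> deg_m2; pose m := (top_monomial - m2)%MM.
    have le_m2 : (m2 <= top_monomial)%MM by rewrite -in_boxE.
    have box_m : in_box d m by rewrite in_boxE lem_subr.
    have deg_m : mdeg m = i by rewrite deg_sub // deg_m2; lia.
    have lt_m : (mdeg m < i.+2)%N by rewrite deg_m.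
    rewrite -(subm_subK le_m2) -/m; apply: etrans (phi_dual (Sub m lt_m)).
    rewrite /F mulr_sumr raddf_sum /= big_mkcond; apply: eq_bigr => m1 _.
    rewrite /A' /= deg_m eqxx andbT /P; case: ifP => [/andP[box_m1 _] | _].
      by rewrite -scalerAr mcoeffZ dual // mulrC.
    by rewrite mul0r.
  have : F \in I by apply: inj hF lF; lia.
  move/power_idealP => /(_ (top_monomial - m')%MM); rewrite in_boxE lem_subr => /(_ isT).
  rewrite /F raddf_sum /= (bigD1 m') /=; last by rewrite /P box_m' deg_m' eqxx.
  rewrite mcoeffZ mcoeffX eqxx mulr1 big1 ?addr0 // => m1 /andP[/andP[box_m1 _] ne_m1].
  rewrite mcoeffZ mcoeffX; case: eqP => [E|_]; last by rewrite mulr0.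
  case/eqP: ne_m1; apply/val_inj; rewrite /= -(@subm_subK _ m1 top_monomial) -?in_boxE //.
  by rewrite E subm_subK // -in_boxE.
pose F : {mpoly K[n]} := \sum_(m : 'X_{1..n < i.+2} | mdeg m == i) f m *: 'X_[m].
have hF : F \is i.-homog.
  by apply: rpred_sum => m /eqP deg_m; apply: rpredZ; rewrite dhomogX /= deg_m.
exists (\pic F); first by exists F.
rewrite -rmorphM; apply/pi_eqP/power_idealP => m' box_m'.
case: (eqVneq (mdeg m') i.+1) => [deg_m' | ne]; last first.
  have hlF : l * F - g \is i.+1.-homog.
    by apply: rpredB hg; rewrite -add1n; apply: dhomogM hl hF.
  exact: dhomog_nemf_coeff hlF ne.
have lt_m' : (mdeg m' < i.+2)%N by rewrite deg_m'.
have := fE (Sub m' lt_m'); rewrite /g' /A' /= box_m' deg_m' eqxx /= => E.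
rewrite mcoeffB -E /F mulr_sumr raddf_sum /= big_mkcond -sumrB big1 // => m _.
by case: ifP => _; rewrite ?mulr0 ?subrr // -scalerAr mcoeffZ subrr.
Qed.

End Lefschetz.

(** * Short strings *)

Section ShortStrings.
Local Open Scope ring_scope.
Variable K : fieldType.
Implicit Types (g h : nat -> nat -> K) (f : nat -> nat -> nat -> nat -> K).

Definition homog2 (j : nat) g : Prop := forall u v, (u + v)%N <> j -> g u v = 0.

Lemma homog2_iter a b j c g : homog2 j g -> homog2 (j + c) (iter c (mul2 a b) g).
Proof.
move=> hg; elim: c => [|c IH] u v uv; first by apply: hg; lia.
rewrite iterS /mul2.
have -> : (if u is u'.+1 then iter c (mul2 a b) g u' v else 0) = 0.
  by case: u uv => // u uv; apply: IH; lia.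
have -> : (if v is v'.+1 then iter c (mul2 a b) g u v' else 0) = 0.
  by case: v uv => // v uv; apply: IH; lia.
by rewrite !mulr0 addr0.
Qed.

Lemma left_kernel_nonzero (m n : nat) (A : 'M[K]_(m, n)) : (n < m)%N ->
  exists2 v : 'rV[K]_m, v != 0 & v *m A = 0.
Proof.
move=> lt_nm; have : kermx A != 0.
  by rewrite -mxrank_eq0 mxrank_ker; have := rank_leq_col A; lia.
by case/rowV0Pn => v /sub_kermxP vA v0; exists v.
Qed.

(** There are [al + 1] unknown coefficients, and at most [al] of the coefficients of
    the product are constrained. *)
Lemma short_string_poly (a b : K) (e1 e2 al c : nat) :
  (al < e1)%N -> (al < e2)%N -> (e1 + e2 <= c + 2 * al + 2)%N ->
  exists P : {poly K}, [/\ P != 0, (size P <= al.+1)%N &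
    forall w, (w < e1)%N -> (al + c.+1 < w + e2)%N ->
      ((a *: 'X + b%:P) ^+ c.+1 * P)`_w = 0].
Proof.
(* the constrained coefficients are those of index at least [w0] and less than [e1] *)
move=> lt1 lt2 le_e; set L := _ ^+ c.+1; pose w0 := (al + c.+2 - e2)%N.
have [v v0 vA] := left_kernel_nonzero
  (\matrix_(i < al.+1, j < al) (L * 'X^i)`_(w0 + j)) (ltnSn al).
exists (rVpoly v); split; [ | exact: size_poly |].
  by rewrite -(rVpolyK v) in v0; apply: contraNneq v0 => ->; rewrite linear0.
move=> w lt_w lt_w2; have lt_j : (w - w0 < al)%N by rewrite /w0; lia.
have := congr1 (fun B : 'rV_al => B 0 (Ordinal lt_j)) vA; rewrite /= !mxE => E.
have -> : rVpoly v = \sum_i v 0 i *: 'X^i.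
  by rewrite /rVpoly poly_def; apply: eq_bigr => i _; rewrite valK.
rewrite mulr_sumr coef_sum -[RHS]E; apply: eq_bigr => i _.
by rewrite -scalerAr coefZ !mxE /= subnKC // /w0; lia.
Qed.

(** The hypothesis on [r1] and [d1] says that [x^(w * q + r1)] is nonzero modulo
    [x^d1] exactly when [w < e1]; so multiplying by [x^r1 * z^r2] after the
    substitution of [x^q, z^q] for [x, z] sends nonzero elements of
    [K[x, z] / (x^e1, z^e2)] to nonzero elements of [K[x, z] / (x^d1, z^d2)]. *)
Lemma frobenius_string (p e : nat) (a b : K) (d1 d2 e1 e2 r1 r2 al c : nat) :
  p \in [pchar K] -> let q := (p ^ e)%N in
  (forall w, (w * q + r1 < d1)%N = (w < e1)%N) ->
  (forall w, (w * q + r2 < d2)%N = (w < e2)%N) ->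
  (al < e1)%N -> (al < e2)%N -> (e1 + e2 <= c + 2 * al + 2)%N ->
  exists2 g, homog2 (al * q + r1 + r2) g &
    (exists u v, [/\ (u < d1)%N, (v < d2)%N & g u v != 0]) /\
    (forall u v, (u < d1)%N -> (v < d2)%N ->
       iter (c.+1 * q) (mul2 a b) g u v = 0).
Proof.
move=> pK q dig1 dig2 lt1 lt2 le_e.
have q0 : (0 < q)%N by rewrite expn_gt0 prime_gt0 ?(pcharf_prime pK).
have [P [P0 sP kerP]] := short_string_poly (a ^+ q) (b ^+ q) lt1 lt2 le_e.
pose R := (P \Po 'X^q) * 'X^r1; set u0 := (al * q + r1 + r2)%N.
have RE w : R`_(w * q + r1) = P`_w.
  by rewrite coefMXn ifF ?addnK ?coef_comp_poly_Xn ?dvdn_mull ?mulnK //; lia.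
pose g u v := if (u + v == u0)%N then R`_u else 0.
have hg : homog2 u0 g by move=> u v /eqP/negPf uv; rewrite /g uv.
have dehomE : dehom u0 g = R.
  apply/polyP => w; rewrite coef_poly; case: ltnP => le_w.
    by rewrite /g ifT //; apply/eqP; lia.
  rewrite coefMXn; case: ltnP => // le_rw; rewrite coef_comp_poly_Xn //.
  case: ifP => // /dvdnP [i iE]; rewrite iE mulnK //.
  by rewrite nth_default //; apply: leq_trans sP _; rewrite /u0 in le_w; nia.
have frob : (a *: 'X + b%:P) ^+ q = (a ^+ q *: 'X + (b ^+ q)%:P) \Po 'X^q.
  rewrite exprDn_pchar; last first.
    by rewrite pnatX pnatE ?(pcharf_prime pK) // pchar_poly pK.
  by rewrite exprZn comp_polyD comp_polyZ comp_polyX comp_polyC polyC_exp.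
exists g => //; split.
  have [i Pi] : exists i, P`_i != 0.
    by exists (size P).-1; rewrite -lead_coefE lead_coef_eq0.
  have le_i : (i <= al)%N.
    by rewrite leqNgt; apply: contraNN Pi => lt_i; rewrite nth_default // (leq_trans sP).
  exists (i * q + r1)%N, ((al - i) * q + r2)%N; split; first by rewrite dig1; lia.
    by rewrite dig2; lia.
  rewrite /g ifT ?RE //; apply/eqP; rewrite /u0 mulnBl.
  by have : (i * q <= al * q)%N; [rewrite leq_mul2r le_i orbT | lia].
move=> u v lt_u lt_v; case: (eqVneq (u + v)%N (u0 + c.+1 * q)%N) => [uv | /eqP ne]; last first.
  exact: homog2_iter ne.
rewrite (iter_mul2E _ _ _ uv) dehomE mulnC exprM frob -rmorphXn /= /R mulrA -rmorphM /=.
rewrite coefMXn; case: ltnP => // le_ru; rewrite coef_comp_poly_Xn //.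
case: ifP => // /dvdnP [w wE]; have uE : u = (w * q + r1)%N by lia.
rewrite wE mulnK //; case: (leqP w (al + c.+1)) => [le_w | lt_w]; last first.
  by apply: nth_default; apply: leq_trans (size_lin_exp_mul _ _ _ sP) _; lia.
apply: kerP; first by rewrite -dig1 -uE.
have : (al + c.+1 - w < e2)%N; last lia.
rewrite -dig2 mulnBl; have : (w * q <= (al + c.+1) * q)%N by rewrite leq_mul2r le_w orbT.
by move: uv lt_v; rewrite uE /u0 mulnDl; lia.
Qed.

Section PairKernel.
Variables (a1 a2 a3 a4 : K) (d1 d2 d3 d4 : nat).

(** The alternating sum telescopes under multiplication by the linear form.  For it to
    be nonzero one takes the least exponent that kills both factors, so that one of its
    two extreme terms survives. *)
Lemma pair_kernel (j1 j2 C : nat) g h :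
  homog2 j1 g -> homog2 j2 h ->
  (exists u v, [/\ (u < d1)%N, (v < d2)%N & g u v != 0]) ->
  (exists u v, [/\ (u < d3)%N, (v < d4)%N & h u v != 0]) ->
  (forall u v, (u < d1)%N -> (v < d2)%N -> iter C.+1 (mul2 a1 a2) g u v = 0) ->
  (forall u v, (u < d3)%N -> (v < d4)%N -> iter C.+1 (mul2 a3 a4) h u v = 0) ->
  exists i f, [/\ (i <= j1 + j2 + C)%N,
    forall x y z w, (x + y + z + w)%N <> i -> f x y z w = 0,
    exists x y z w, [/\ (x < d1)%N, (y < d2)%N, (z < d3)%N & (w < d4)%N] /\
       f x y z w != 0 &
    forall x y z w, (x < d1)%N -> (y < d2)%N -> (z < d3)%N -> (w < d4)%N ->
      mul12 a1 a2 f x y z w + mul34 a3 a4 f x y z w = 0].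
Proof.
move=> hg hh g0 h0 killg killh.
(* the exponent is one more than [c], so that the least value leaves some factor alive *)
pose kills c := `[<
  (forall u v, (u < d1)%N -> (v < d2)%N -> iter c.+1 (mul2 a1 a2) g u v = 0) /\
  (forall u v, (u < d3)%N -> (v < d4)%N -> iter c.+1 (mul2 a3 a4) h u v = 0) >].
have ex_kills : exists c, kills c by exists C; apply/asboolP.
case: (ex_minnP ex_kills) => c /asboolP [{}killg' killh'] min_c.
have le_cC : (c <= C)%N by apply: min_c; apply/asboolP.
have alive : (exists u v, [/\ (u < d1)%N, (v < d2)%N & iter c (mul2 a1 a2) g u v != 0]) \/
             (exists u v, [/\ (u < d3)%N, (v < d4)%N & iter c (mul2 a3 a4) h u v != 0]).
  case: c min_c {killg' killh' le_cC} => [|c] min_c; first by left.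
  apply: contrapT => /not_orP [ng nh]; have : (c.+1 <= c)%N; last by rewrite ltnn.
  apply: min_c; apply/asboolP; split=> u v lt_u lt_v; apply/eqP; apply: contrapT => ne.
    by apply: ng; exists u, v; split=> //; apply/negP.
  by apply: nh; exists u, v; split=> //; apply/negP.
pose gt j := iter j (mul2 a1 a2) g; pose ht j := iter j (mul2 a3 a4) h.
pose f x y z w := \sum_(j < c.+1) (-1) ^+ j * gt j x y * ht (c - j)%N z w.
exists (j1 + j2 + c)%N, f; split; first lia.
- move=> x y z w ne; apply: big1 => j _; have lt_j := ltn_ord j.
  case: (eqVneq (x + y)%N (j1 + j)%N) => [xy | /eqP xy]; last first.
    by rewrite /gt (homog2_iter _ _ hg xy) mulr0 mul0r.
  by rewrite /ht (homog2_iter _ _ hh) ?mulr0 //; lia.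
- have fE (j : 'I_c.+1) x y z w : (x + y = j1 + j)%N ->
      f x y z w = (-1) ^+ j * gt j x y * ht (c - j)%N z w.
    move=> xy; rewrite /f (bigD1 j) //= big1 ?addr0 // => l ne_lj.
    rewrite /gt (homog2_iter _ _ hg) ?mulr0 ?mul0r // => xy'.
    by case/eqP: ne_lj; apply/val_inj => /=; lia.
  have sumE j x y : gt j x y != 0 -> (x + y = j1 + j)%N.
    move=> ne; apply/eqP; apply: contraNT ne => /eqP ne.
    by rewrite /gt (homog2_iter _ _ hg ne).
  case: alive => [[x [y [hx hy ne]]] | [z [w [hz hw ne]]]].
    case: h0 => z [w [hz hw ne']]; exists x, y, z, w; split=> //.
    rewrite (fE ord_max) /=; last exact: sumE.
    by rewrite subnn !mulf_neq0 // signr_eq0.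
  case: g0 => x [y [hx hy ne']]; exists x, y, z, w; split=> //.
  rewrite (fE ord0) /=; last exact: (sumE 0%N).
  by rewrite subn0 mul1r !mulf_neq0.
move=> x y z w hx hy hz hw.
have E12 : mul12 a1 a2 f x y z w = \sum_(j < c.+1) (-1) ^+ j * gt j.+1 x y * ht (c - j)%N z w.
  rewrite /mul12 /mul2 /f; transitivity (\sum_(j < c.+1) (
      a1 * (if x is x'.+1 then (-1) ^+ j * gt j x' y * ht (c - j)%N z w else 0) +
      a2 * (if y is y'.+1 then (-1) ^+ j * gt j x y' * ht (c - j)%N z w else 0))).
    rewrite big_split /= -!mulr_sumr; congr (_ * _ + _ * _).
      by case: x {hx} => [|x]; [rewrite big1 | ].
    by case: y {hy} => [|y]; [rewrite big1 | ].
  apply: eq_bigr => j _; rewrite /gt iterS /mul2.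
  by case: x {hx} => [|x]; case: y {hy} => [|y]; ring.
have E34 : mul34 a3 a4 f x y z w = \sum_(j < c.+1) (-1) ^+ j * gt j x y * ht (c - j).+1 z w.
  clear E12; rewrite /mul34 /mul2 /f; transitivity (\sum_(j < c.+1) (
      a3 * (if z is z'.+1 then (-1) ^+ j * gt j x y * ht (c - j)%N z' w else 0) +
      a4 * (if w is w'.+1 then (-1) ^+ j * gt j x y * ht (c - j)%N z w' else 0))).
    rewrite big_split /= -!mulr_sumr; congr (_ * _ + _ * _).
      by case: z {hz} => [|z]; [rewrite big1 | ].
    by case: w {hw} => [|w]; [rewrite big1 | ].
  apply: eq_bigr => j _; rewrite /ht iterS /mul2.
  by case: z {hz} => [|z]; case: w {hw} => [|w]; ring.
rewrite E12 E34 big_ord_recr [X in _ + X]big_ord_recl /=.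
have -> : mul2 a1 a2 (gt c) x y = 0 by apply: killg'.
have -> : mul2 a3 a4 (ht (c - 0)%N) z w = 0 by rewrite subn0; apply: killh'.
rewrite !mulr0 mul0r addr0 add0r -big_split /= big1 // => j _.
rewrite /bump /= !add1n add0n exprS.
have -> : (c - j = (c - j.+1).+1)%N by have := ltn_ord j; lia.
rewrite {1}/ht iterS -/(ht _); ring.
Qed.

End PairKernel.
End ShortStrings.

(** * Exponents in four variables *)

Lemma ord4_ind (P : 'I_4 -> Prop) :
  P (inord 0) -> P (inord 1) -> P (inord 2) -> P (inord 3) -> forall i, P i.
Proof.
move=> P0 P1 P2 P3 i; have -> : i = inord (val i) by rewrite inord_val.
by case: i => [[|[|[|[|i]]]]].
Qed.

Lemma big_ord4 (R : Type) (idx : R) (op : Monoid.law idx) (F : 'I_4 -> R) :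
  \big[op/idx]_(i < 4) F i =
  op (op (op (F (inord 0)) (F (inord 1))) (F (inord 2))) (F (inord 3)).
Proof.
rewrite !big_ord_recl big_ord0 Monoid.mulm1 !Monoid.mulmA.
by congr (op (op (op _ _) _) _); congr F; apply/val_inj; rewrite /= inordK.
Qed.

Section Four.
Local Open Scope ring_scope.
Variables (K : fieldType) (d : 'I_4 -> nat) (d_gt0 : forall i, (0 < d i)%N).
Let d1 := d (inord 0). Let d2 := d (inord 1).
Let d3 := d (inord 2). Let d4 := d (inord 3).

Definition mnm4 (x y z w : nat) : 'X_{1..4} :=
  [multinom nth 0%N [:: x; y; z; w] i | i < 4].

Lemma mnm4E x y z w : (mnm4 x y z w (inord 0) = x) * (mnm4 x y z w (inord 1) = y) *
  (mnm4 x y z w (inord 2) = z) * (mnm4 x y z w (inord 3) = w).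
Proof. by rewrite !mnmE !inordK. Qed.

Lemma mnm4_eta (m : 'X_{1..4}) :
  m = mnm4 (m (inord 0)) (m (inord 1)) (m (inord 2)) (m (inord 3)).
Proof. by apply/mnmP; apply: ord4_ind; rewrite !mnm4E. Qed.

Lemma mdeg_mnm4 x y z w : mdeg (mnm4 x y z w) = (x + y + z + w)%N.
Proof. by rewrite mdegE big_ord4 !mnm4E. Qed.

Lemma in_box_mnm4 x y z w :
  in_box d (mnm4 x y z w) = [&& x < d1, y < d2, z < d3 & w < d4]%N.
Proof.
apply/forallP/and4P => [H | [h1 h2 h3 h4]]; last by apply: ord4_ind; rewrite !mnm4E.
by have := (H (inord 0), H (inord 1), H (inord 2), H (inord 3));
  rewrite !mnm4E => -[[[]]].
Qed.

Lemma socle_degree4 : (socle_degree d + 4 = d1 + d2 + d3 + d4)%N.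
Proof.
rewrite /socle_degree big_ord4 /= /d1 /d2 /d3 /d4.
have := (d_gt0 (inord 0), d_gt0 (inord 1), d_gt0 (inord 2), d_gt0 (inord 3)).
by move=> [[[]]]; lia.
Qed.

Definition coef4 (f : {mpoly K[4]}) x y z w : K := f@_(mnm4 x y z w).

Lemma coef4_lin_mul (a : 'I_4 -> K) f x y z w :
  coef4 ((\sum_i a i *: 'X_i) * f) x y z w =
  mul12 (a (inord 0)) (a (inord 1)) (coef4 f) x y z w +
  mul34 (a (inord 2)) (a (inord 3)) (coef4 f) x y z w.
Proof.
rewrite /coef4 mcoeff_lin_mul big_ord4 /= !mnm4E /mul12 /mul34 /mul2 -!addrA.
have sub4 x' y' z' w' i : (mnm4 x' y' z' w' - U_(i))%MM =
    mnm4 (x' - (i == inord 0)) (y' - (i == inord 1))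
      (z' - (i == inord 2)) (w' - (i == inord 3)).
  by apply/mnmP; apply: ord4_ind; rewrite mnmBE mnm1E !mnm4E.
have ne (j k : nat) : (j < 4)%N -> (k < 4)%N ->
    (inord j == inord k :> 'I_4) = (j == k).
  by move=> hj hk; rewrite -val_eqE /= !inordK.
rewrite !sub4 !ne //= !subn0.
by congr (_ * _ + (_ * _ + (_ * _ + _ * _)));
  [case: x | case: y | case: z | case: w] => //= t; rewrite subn1.
Qed.

Lemma mpoly_of_coef4 i (f : nat -> nat -> nat -> nat -> K) :
  (forall x y z w, (x + y + z + w)%N <> i -> f x y z w = 0) ->
  exists2 F : {mpoly K[4]}, F \is i.-homog & forall x y z w, coef4 F x y z w = f x y z w.
Proof.
move=> hf; pose E (m : 'X_{1..4}) :=
  f (m (inord 0)) (m (inord 1)) (m (inord 2)) (m (inord 3)).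
pose F : {mpoly K[4]} := \sum_(m : 'X_{1..4 < i.+1} | mdeg m == i) E m *: 'X_[m].
have hF : F \is i.-homog.
  by apply: rpred_sum => m /eqP deg_m; apply: rpredZ; rewrite dhomogX /= deg_m.
exists F => // x y z w; rewrite /coef4.
case: (eqVneq (x + y + z + w)%N i) => [sum | ne]; last first.
  rewrite hf; last exact/eqP.
  by apply: dhomog_nemf_coeff hF _; rewrite /= mdeg_mnm4.
have lt_m : (mdeg (mnm4 x y z w) < i.+1)%N by rewrite mdeg_mnm4 sum.
rewrite /F raddf_sum (bigD1 (Sub (mnm4 x y z w) lt_m)) /= ?mdeg_mnm4 ?sum //.
rewrite mcoeffZ mcoeffX eqxx mulr1 /E !mnm4E big1 ?addr0 // => m /andP[_ ne].
rewrite mcoeffZ mcoeffX; case: eqP => [E'|_]; last by rewrite mulr0.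
by case/eqP: ne; apply/val_inj.
Qed.

Lemma injective_kernel_bound (a : 'I_4 -> K) i f :
  below_middle_injective d (\sum_i a i *: 'X_i : {mpoly K[4]}) ->
  (forall x y z w, (x + y + z + w)%N <> i -> f x y z w = 0) ->
  (exists x y z w, [/\ (x < d1)%N, (y < d2)%N, (z < d3)%N & (w < d4)%N] /\
      f x y z w != 0) ->
  (forall x y z w, (x < d1)%N -> (y < d2)%N -> (z < d3)%N -> (w < d4)%N ->
      mul12 (a (inord 0)) (a (inord 1)) f x y z w +
      mul34 (a (inord 2)) (a (inord 3)) f x y z w = 0) ->
  (socle_degree d <= 2 * i)%N.
Proof.
move=> inj hf [x [y [z [w [[hx hy hz hw] ne]]]]] ker.
have [F hF FE] := mpoly_of_coef4 hf.
rewrite leqNgt; apply: contraNN ne => lt_i.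
have : F \in power_ideal d.
  apply: inj lt_i hF _; apply/power_idealP => m; rewrite (mnm4_eta m) in_box_mnm4.
  case/and4P => h1 h2 h3 h4; rewrite -/(coef4 _ _ _ _ _) coef4_lin_mul.
  rewrite -[RHS](ker _ _ _ _ h1 h2 h3 h4).
  congr (_ + _).
    by rewrite /mul12 /mul2; case: (m (inord 0)) => [|?];
      case: (m (inord 1)) => [|?]; rewrite ?FE.
  by rewrite /mul34 /mul2; case: (m (inord 2)) => [|?];
    case: (m (inord 3)) => [|?]; rewrite ?FE.
move/power_idealP => /(_ (mnm4 x y z w)); rewrite in_box_mnm4 hx hy hz hw => /(_ isT).
by rewrite -/(coef4 _ _ _ _ _) FE => ->.
Qed.

(** The kernel element that [pair_kernel] makes of two Frobenius strings cannot lie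
    below the middle degree. *)
Lemma weak_Lefschetz_string_bound (p e : nat) (e1 e2 e3 e4 r1 r2 r3 r4 al be c : nat) :
  p \in [pchar K] -> let q := (p ^ e)%N in
  weak_Lefschetz (@monomial_ci_deg K 4 d d_gt0) ->
  (forall w, (w * q + r1 < d1)%N = (w < e1)%N) ->
  (forall w, (w * q + r2 < d2)%N = (w < e2)%N) ->
  (forall w, (w * q + r3 < d3)%N = (w < e3)%N) ->
  (forall w, (w * q + r4 < d4)%N = (w < e4)%N) ->
  (al < e1)%N -> (al < e2)%N -> (be < e3)%N -> (be < e4)%N ->
  (e1 + e2 <= c + 2 * al + 2)%N -> (e3 + e4 <= c + 2 * be + 2)%N ->
  (d1 + d2 + d3 + d4 <= 2 * ((al + be + c.+1) * q + r1 + r2 + r3 + r4) + 2)%N.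
Proof.
move=> pK q /weak_Lefschetz_injective [l hl inj] dg1 dg2 dg3 dg4 l1 l2 l3 l4 le1 le2.
rewrite (homog1_lin hl) in inj; set a := fun i => l@_(U_(i)) in inj.
have q0 : (0 < q)%N by rewrite expn_gt0 prime_gt0 ?(pcharf_prime pK).
have [g hg [g0 kg]] := frobenius_string (a (inord 0)) (a (inord 1)) pK dg1 dg2 l1 l2 le1.
have [h hh [h0 kh]] := frobenius_string (a (inord 2)) (a (inord 3)) pK dg3 dg4 l3 l4 le2.
have C1 : ((c.+1 * q).-1.+1 = c.+1 * q)%N by rewrite prednK // muln_gt0.
have := @pair_kernel K (a (inord 0)) (a (inord 1)) (a (inord 2)) (a (inord 3))
  d1 d2 d3 d4 _ _ (c.+1 * q).-1 g h hg hh g0 h0.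
rewrite !C1 => /(_ kg kh) [i [f [le_i hf f0 kf]]].
have := injective_kernel_bound inj hf f0 kf; have := socle_degree4.
by move: le_i C1; rewrite -/q !mulnDl; lia.
Qed.

Lemma weak_Lefschetz_of_kernel :
  (forall i (f : nat -> nat -> nat -> nat -> K),
    (2 * i + 5 <= d1 + d2 + d3 + d4)%N ->
    eq_on_box d1 d2 d3 d4 i.+1 (fun x y z w => mul12 1 1 f x y z w + mul34 1 1 f x y z w)
      (fun _ _ _ _ => 0) ->
    eq_on_box d1 d2 d3 d4 i f (fun _ _ _ _ => 0)) ->
  weak_Lefschetz (@monomial_ci_deg K 4 d d_gt0).
Proof.
move=> inj; apply: (@injective_weak_Lefschetz _ _ _ _ (fun=> 1)).
move=> i f lt_i hf /power_idealP lf; apply/power_idealP => m.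
rewrite (mnm4_eta m) in_box_mnm4 => /and4P[h1 h2 h3 h4].
case: (eqVneq (mdeg m) i) => [deg_m | ne]; last first.
  by rewrite -mnm4_eta (dhomog_nemf_coeff hf).
apply: (inj i (coef4 f)) => //.
- by have := socle_degree4; lia.
- move=> x y z w hx hy hz hw _.
  by rewrite -(coef4_lin_mul (fun=> 1)) /coef4 lf // in_box_mnm4 hx hy hz hw.
- by rewrite -mdeg_mnm4 -mnm4_eta.
Qed.

End Four.

(** * Arithmetic of the exponents *)

(** [q] is an odd multiple of [p^f], so that half of [q] is half of [p^f] modulo
    [p^f]. *)
Lemma central_half (p e k l r s : nat) : odd p -> prime p ->
  let h := (p ^ e)./2 in
  (r = h \/ r = h.+1) -> (s = h \/ s = h.+1) ->
  forall f, 1 <= f <= e -> central (p ^ f) (k * p ^ e + r) (l * p ^ e + s).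
Proof.
move=> odd_p pr_p h hr hs f /andP[f_gt0 le_fe].
have odd_pow n : odd (p ^ n) by rewrite oddX odd_p orbT.
have [Q3 qE] : 3 <= p ^ f /\ p ^ e = p ^ (e - f) * p ^ f.
  split; last by rewrite -expnD subnK.
  apply: leq_trans (leq_pexp2l _ f_gt0); rewrite ?expn1 ?prime_gt0 //.
  by move: (prime_gt1 pr_p) odd_p; lia.
have := odd_pow f; have := odd_pow (e - f)%N; rewrite {}/h qE in hr hs *.
move: (p ^ f) (p ^ (e - f)) Q3 hr hs => Q t Q3 hr hs odd_t odd_Q.
have hE : (t * Q)./2 = t./2 * Q + Q./2.
  have := odd_double_half t; rewrite odd_t add1n -mul2n => tE.
  have : t * Q = 2 * (t./2 * Q) + Q by rewrite -{1}tE mulSn -mulnA addnC.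
  by move: (t * Q) (t./2 * Q) => M N; lia.
have mod_half i j : (i = (t * Q)./2 \/ i = ((t * Q)./2).+1) ->
    (j * (t * Q) + i) %% Q = Q./2 \/ (j * (t * Q) + i) %% Q = Q./2.+1.
  case=> ->; [left | right]; rewrite hE -?addnS mulnA addnA -mulnDl modnMDl modn_small //; lia.
split; case: (mod_half r k hr) => ->; case: (mod_half s l hs) => ->; lia.
Qed.

(** Rounding the exponent [k * q + r] down, to be used with [frobenius_string]. *)
Lemma digit_low (q k r w : nat) : 0 < q -> (w * q + r < k * q + r) = (w < k).
Proof. by move=> q0; rewrite ltn_add2r ltn_pmul2r. Qed.

(** Rounding the exponent [k * q + r] up to [(k + 1) * q]: as [r > 0], the top power
    [x^(k * q)] is still nonzero. *)
Lemma digit_high (q k r w : nat) : 0 < r < q -> (w * q + 0 < k * q + r) = (w < k.+1).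
Proof.
move=> /andP[r0 lt_rq]; rewrite addn0 ltnS; case: (leqP w k) => [le_wk | lt_kw].
  by apply: leq_ltn_trans (_ : k * q < _); rewrite ?leq_mul2r ?le_wk ?orbT //; lia.
apply/negbTE; rewrite -leqNgt; apply: leq_trans (_ : k.+1 * q <= _).
  by rewrite mulSn; lia.
by rewrite leq_mul2r lt_kw orbT.
Qed.

(** The strings in the two factors are given the same length: [c] is the larger of
    [x] and [y], which are the differences of the exponents in the application. *)
Lemma balanced_lengths (a x b y : nat) : 0 < a -> 0 < b -> odd x = odd y ->
  x + 2 <= 2 * b + y -> y + 2 <= 2 * a + x ->
  exists al be c, [/\ al < a, be < b, 2 * a + x = c + 2 * al + 2 &
    2 * b + y = c + 2 * be + 2].
Proof.
have main a' x' b' z : 0 < a' -> 0 < b' -> 2 * z + 2 <= 2 * a' ->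
    exists al be c, [/\ al < a', be < b', 2 * a' + x' = c + 2 * al + 2 &
      2 * b' + (x' + 2 * z) = c + 2 * be + 2].
  by move=> a0 b0 le_z; exists (a' - z.+1), b'.-1, (x' + 2 * z); split; lia.
have half m n : m <= n -> odd m = odd n -> n = m + 2 * (n - m)./2.
  move=> le_mn odd_mn; have := odd_double_half (n - m).
  by rewrite oddB // odd_mn addbb add0n -mul2n => ->; rewrite subnKC.
move=> a0 b0 odd_xy le1 le2; case: (leqP x y) => [le_xy | /ltnW le_yx].
  have E := half _ _ le_xy odd_xy; rewrite {1}E.
  by apply: main => //; rewrite E in le2; lia.
have E := half _ _ le_yx (esym odd_xy); rewrite {1}E.
have [|be [al [c [h1 h2 h3 h4]]]] := main b y a (x - y)./2 b0 a0.
  by rewrite E in le1; lia.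
by exists al, be, c.
Qed.

Lemma balanced_pairs (e1 e2 e3 e4 : nat) : 0 < e1 -> 0 < e2 -> 0 < e3 -> 0 < e4 ->
  odd (e1 + e2) = odd (e3 + e4) ->
  e1 + 2 <= e2 + e3 + e4 -> e2 + 2 <= e1 + e3 + e4 ->
  e3 + 2 <= e1 + e2 + e4 -> e4 + 2 <= e1 + e2 + e3 ->
  exists al be c, [/\ al < e1 /\ al < e2, be < e3 /\ be < e4,
    e1 + e2 = c + 2 * al + 2 & e3 + e4 = c + 2 * be + 2].
Proof.
have split2 m n : exists a x, [/\ a <= m, a <= n, m + n = 2 * a + x,
    (m = a \/ n = a) & m + n = m + m + x \/ m + n = n + n + x].
  case: (leqP m n) => [le_mn | /ltnW le_nm]; [exists m, (n - m) | exists n, (m - n)].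
    by split; [| | lia | left | left; lia].
  by split; [| | lia | right | right; lia].
move=> p1 p2 p3 p4 oddE h1 h2 h3 h4.
have [a [x [a1 a2 E12 aE aE']]] := split2 e1 e2.
have [b [y [b1 b2 E34 bE bE']]] := split2 e3 e4.
rewrite E12 E34 in oddE; rewrite !mul2n !oddD !odd_double /= in oddE.
have a0 : 0 < a by case: aE => <-.
have b0 : 0 < b by case: bE => <-.
have le1 : x + 2 <= 2 * b + y by rewrite -E34; case: aE => aE; lia.
have le2 : y + 2 <= 2 * a + x by rewrite -E12; case: bE => bE; lia.
have [al [be [c [la lb Ea Eb]]]] := balanced_lengths a0 b0 oddE le1 le2.
exists al, be, c; rewrite E12 E34; split=> //.
  by split; apply: leq_trans la _.
by split; apply: leq_trans lb _.
Qed.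

(** In the exceptional cases the parity makes the socle degree even. *)
Lemma remainder_cases (h r1 r2 r3 r4 : nat) (odS : bool) : 0 < h ->
  r1 <= r2 -> r2 <= r3 -> r3 <= r4 ->
  (odS /\ (h.*2.+1 + r4 <= r1 + r2 + r3 + 2 /\ r2 + r3 + r4 <= h.*2.+1 + r1 + 2) \/
   ~~ odS /\ (2 * h.*2.+1 <= r1 + r2 + r3 + r4 + 2 /\
     r1 + r2 + r3 + r4 <= 2 * h.*2.+1 + 2 /\ r3 + r4 <= r1 + r2 + 2)) ->
  let mid r := r = h \/ r = h.+1 in
  [\/ [/\ mid r1, mid r2, mid r3 & mid r4],
      [/\ r1.+1 = h, mid r2, mid r3, mid r4 & odd (r1 + r2 + r3 + r4) = odS] |
      [/\ mid r1, mid r2, mid r3, r4 = h.+2 & odd (r1 + r2 + r3 + r4) = odS]].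
Proof.
move=> h0 l1 l2 l3 H mid; rewrite /mid.
have H1 : h <= r1.+1 by case: H; lia.
have H4 : r4 <= h.+2 by case: H; lia.
have [e1|e1] : h <= r1 \/ r1.+1 = h by lia.
  have [e4|e4] : r4 <= h.+1 \/ r4 = h.+2 by lia.
    by apply: Or31; split; lia.
  by apply: Or33; split; case: H; lia.
by apply: Or32; split; case: H; lia.
Qed.

(** * The criterion *)

Lemma ge3_odd_power (p e : nat) : prime p -> odd p -> 0 < e -> 3 <= p ^ e.
Proof.
move=> pr_p odd_p e0.
apply: leq_trans (leq_pexp2l (prime_gt0 pr_p) e0); rewrite expn1.
by move: (prime_gt1 pr_p) odd_p; lia.
Qed.

Lemma powers_injective_half (K : fieldType) (p e k l r s : nat) :
  (p \in [pchar K])%R -> let q := p ^ e in odd p -> 0 < e -> k < p -> l < p ->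
  (r = q./2 \/ r = q./2.+1) -> (s = q./2 \/ s = q./2.+1) ->
  powers_injective K (p ^ e.+1) (k * q + r) (l * q + s) 0.
Proof.
move=> charK q odd_p e0 lt_kp lt_lp hr hs; have pr_p := pcharf_prime charK.
have q3 : 3 <= q := ge3_odd_power pr_p odd_p e0.
have le_Q t u : t < p -> u <= q -> t * q + u <= p ^ e.+1.
  move=> lt_tp le_uq; rewrite expnS -/q; apply: leq_trans (_ : t.+1 * q <= _).
    by rewrite mulSn; lia.
  by rewrite leq_mul2r lt_tp orbT.
apply: powers_injective_central => //; try by apply: le_Q => //; lia.
exact: central_half.
Qed.

Lemma powers_injective_near_half (K : fieldType) (p e k l r s : nat) :
  (p \in [pchar K])%R -> let q := p ^ e in odd p -> 0 < e -> k < p -> l < p ->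
  r.+1 = q./2 \/ r = q./2.+2 -> r < q -> (s = q./2 \/ s = q./2.+1) ->
  powers_injective K (p ^ e.+1) (k * q + r) (l * q + s) 1.
Proof.
move=> charK q odd_p e0 lt_kp lt_lp hr lt_rq hs; have pr_p := pcharf_prime charK.
have q3 : 3 <= q := ge3_odd_power pr_p odd_p e0.
case: hr => hr; last first.
  rewrite hr addnS; apply: powers_injective_down; apply: powers_injective_half => //.
  by right.
have lt_Q t u : t < p -> u < q -> t * q + u < p ^ e.+1.
  move=> lt_tp lt_uq; rewrite expnS -/q; apply: leq_trans (_ : t.+1 * q <= _).
    by rewrite mulSn; lia.
  by rewrite leq_mul2r lt_tp orbT.
apply: (powers_injective_up charK); [exact: lt_Q | by apply/ltnW/lt_Q => //; lia |].
by rewrite -addnS; apply: powers_injective_half => //; left.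
Qed.

Section KernelFree.
Local Open Scope ring_scope.
Variable K : fieldType.

(** The socle degree being [d1 + d2 + d3 + d4 - 4], the inequality puts [i] below the
    middle. *)
Definition lower_half_injective (d1 d2 d3 d4 : nat) : Prop :=
  forall i (f : nat -> nat -> nat -> nat -> K),
    (2 * i + 5 <= d1 + d2 + d3 + d4)%N ->
    eq_on_box d1 d2 d3 d4 i.+1 (fun x y z w => mul12 1 1 f x y z w + mul34 1 1 f x y z w)
      (fun _ _ _ _ => 0) ->
    eq_on_box d1 d2 d3 d4 i f (fun _ _ _ _ => 0).

Lemma lower_half_injective_pair (Q t d1 d2 d3 d4 : nat) :
  powers_injective K Q d1 d2 t -> powers_injective K Q d3 d4 0 ->
  (d1 + d2 + d3 + d4 <= 2 * Q + 2)%N ->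
  (t = 0 \/ t = 1 /\ ~~ odd (d1 + d2 + d3 + d4))%N -> lower_half_injective d1 d2 d3 d4.
Proof.
move=> injM injN le_Q ht i f le_i ker; apply: (pair_injective injM injN) => //.
  by case: ht => [-> | [-> ev]]; lia.
move=> x y z w hx hy hz hw sum; have := ker x y z w hx hy hz hw sum.
move/eqP; rewrite addr_eq0 => /eqP ->.
by rewrite /mul34 /mul2 !mulN1r !mul1r opprD.
Qed.

Lemma lower_half_injective_swap23 (d1 d2 d3 d4 : nat) :
  lower_half_injective d1 d3 d2 d4 -> lower_half_injective d1 d2 d3 d4.
Proof.
move=> free i f le_i ker x y z w hx hy hz hw sum.
apply: (free i (fun x y z w => f x z y w)) => //; try lia.
move=> x' y' z' w' hx' hy' hz' hw' sum'.
rewrite -[RHS](ker x' z' y' w') //; last lia.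
by rewrite /mul12 /mul34 /mul2 !mul1r addrACA.
Qed.

Lemma lower_half_injective_rev (d1 d2 d3 d4 : nat) :
  lower_half_injective d4 d3 d2 d1 -> lower_half_injective d1 d2 d3 d4.
Proof.
move=> free i f le_i ker x y z w hx hy hz hw sum.
apply: (free i (fun x y z w => f w z y x)) => //; try lia.
move=> x' y' z' w' hx' hy' hz' hw' sum'.
rewrite -[RHS](ker w' z' y' x') //; last lia.
rewrite /mul12 /mul34 /mul2 !mul1r [RHS]addrC; congr (_ + _); exact: addrC.
Qed.

End KernelFree.

Lemma uphalf_leq (n m : nat) : (uphalf n <= m) = (n <= 2 * m).
Proof. lia. Qed.

(** The two string lengths can be balanced exactly when no exponent exceeds the sum of
    the other three by too much; when the sum of the exponents is odd, the lengths have
    different parities, and half a degree is lost. *)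
Lemma weak_Lefschetz_digit_bound (K : fieldType) (d : 'I_4 -> nat)
    (d_gt0 : forall i, 0 < d i) (p e e1 e2 e3 e4 r1 r2 r3 r4 : nat) :
  (p \in [pchar K])%R -> let q := p ^ e in let S := e1 + e2 + e3 + e4 in
  weak_Lefschetz (@monomial_ci_deg K 4 d d_gt0) ->
  (forall w, (w * q + r1 < d (inord 0)) = (w < e1)) ->
  (forall w, (w * q + r2 < d (inord 1)) = (w < e2)) ->
  (forall w, (w * q + r3 < d (inord 2)) = (w < e3)) ->
  (forall w, (w * q + r4 < d (inord 3)) = (w < e4)) ->
  0 < e1 -> 0 < e2 -> 0 < e3 -> 0 < e4 ->
  2 * e1 + 2 + odd S <= S -> 2 * e2 + 2 + odd S <= S ->
  2 * e3 + 2 + odd S <= S -> 2 * e4 + 2 + odd S <= S ->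
  d (inord 0) + d (inord 1) + d (inord 2) + d (inord 3) + 2 * q <=
    (S + odd S) * q + 2 * (r1 + r2 + r3 + r4) + 2.
Proof.
move=> pK q S wlp dg1 dg2 dg3 dg4 p1 p2 p3 p4 h1 h2 h3 h4.
have [al [be [c [[a1 a2] [b3 b4] E12 E34 Ec]]]] : exists al be c,
    [/\ al < e1 /\ al < e2, be < e3 /\ be < e4,
      e1 + e2 = c + 2 * al + 2, e3 + e4 <= c + 2 * be + 2 &
      2 * (al + be + c.+1) + 2 = S + odd S].
  move: h1 h2 h3 h4; rewrite -/S; case: (boolP (odd S)) => oddS /= h1 h2 h3 h4; last first.
    have [|||||al [be [c [a12 b34 E12 E34]]]] := balanced_pairs p1 p2 p3 p4.
    - by move: oddS; rewrite /S -addnA oddD; case: odd; case: odd.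
    - by rewrite /S in h1; lia.
    - by rewrite /S in h2; lia.
    - by rewrite /S in h3; lia.
    - by rewrite /S in h4; lia.
    exists al, be, c; split=> //; first by rewrite E34.
    by rewrite /S -(addnA (e1 + e2)) E12 E34; lia.
  have odd_succ : odd (e1 + e2) = ~~ odd (e3 + e4).
    by move: oddS; rewrite /S -addnA oddD; case: odd; case: odd.
  (* the larger of [e3] and [e4] is increased by one, so that [be] remains smaller *)
  rewrite /S in h1 h2 h3 h4 *; case: (leqP e3 e4) => [le34 | /ltnW le43].
    have [|||||al [be [c [a12 [b3 b4] E12 E34]]]] :=
      @balanced_pairs e1 e2 e3 e4.+1 p1 p2 p3 isT; rewrite ?addnS //; try lia.
    rewrite addnS in E34; exists al, be, c; split=> //; lia.
  have [|||||al [be [c [a12 [b3 b4] E12 E34]]]] :=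
    @balanced_pairs e1 e2 e3.+1 e4 p1 p2 isT p4; rewrite ?addnS ?addSn //; try lia.
  rewrite addSn in E34; exists al, be, c; split=> //; lia.
have := @weak_Lefschetz_string_bound K d d_gt0 p e e1 e2 e3 e4 r1 r2 r3 r4
  al be c pK wlp dg1 dg2 dg3 dg4 a1 a2 b3 b4.
have -> : (S + odd S) * q = 2 * ((al + be + c.+1) * q) + 2 * q by rewrite -Ec mulnDl mulnA.
rewrite E12 leqnn => /(_ isT E34); rewrite -/q.
by move: ((al + be + c.+1) * q) => N; lia.
Qed.

Theorem proposition5p7 (K : fieldType) (K_infinite : infinite_set (@setT K))
    (p e q : nat) (charK : p \in [pchar K]%R)
    (q_def : q = p ^ e) (q_gt1 : 1 < q)
    (d k r : 'I_4 -> nat)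
    (d_def : forall i, d i = k i * q + r i)
    (k_bound : forall i, 1 <= k i <= p - 1)
    (r_bound : forall i, 0 <= r i <= q - 1)
    (k_le : forall i, k i <= (\sum_(j < 4) k j - 2) %/ 2)
    (d_gt0 : forall i, 0 < d i) :
  let r1 := r (inord 0) in
  let r2 := r (inord 1) in
  let r3 := r (inord 2) in
  let r4 := r (inord 3) in
  r1 <= r2 -> r2 <= r3 -> r3 <= r4 ->
  weak_Lefschetz (@monomial_ci_deg K 4 d d_gt0) <->
  ([/\ odd (\sum_(i < 4) k i),
       (q%:Z <= r1%:Z + r2%:Z + r3%:Z - r4%:Z + 2)%R,
       (r2%:Z + r3%:Z + r4%:Z - r1%:Z - 2 <= q%:Z)%R
     & uphalf (\sum_(i < 4) d i - 2) <= p * q]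
   \/
   [/\ ~~ odd (\sum_(i < 4) k i),
       2 * q - 2 <= r1 + r2 + r3 + r4 <= 2 * q + 2,
       r3 + r4 <= r1 + r2 + 2
     & uphalf (\sum_(i < 4) d i - 2) <= p * q]).
Proof.
move=> r1 r2 r3 r4 le12 le23 le34.
have pr_p := pcharf_prime charK.
have e0 : 0 < e by case: e q_def q_gt1 => // ->.
have all4 (P : 'I_4 -> Prop) : (forall i, P i) ->
    [/\ P (inord 0), P (inord 1), P (inord 2) & P (inord 3)] by [].
have [] := all4 _ k_bound; have [] := all4 _ k_le; have [] := all4 _ r_bound.
have [] := all4 _ d_gt0; have [] := all4 _ d_def; rewrite !big_ord4 /=.
rewrite -/r1 -/r2 -/r3 -/r4.
set k1 := k _; set k2 := k _; set k3 := k _; set k4 := k _.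
set d1 := d _; set d2 := d _; set d3 := d _; set d4 := d _.
move=> dE1 dE2 dE3 dE4 dp1 dp2 dp3 dp4 rb1 rb2 rb3 rb4 kl1 kl2 kl3 kl4 kb1 kb2 kb3 kb4.
have dsum : d1 + d2 + d3 + d4 = (k1 + k2 + k3 + k4) * q + (r1 + r2 + r3 + r4).
  by rewrite dE1 dE2 dE3 dE4 !mulnDl; lia.
have QE : p ^ e.+1 = p * q by rewrite expnS q_def.
have q0 : 0 < q by lia.
have [{}kl1 {}kl2 {}kl3 {}kl4] : [/\ 2 * k1 + 2 <= k1 + k2 + k3 + k4,
  2 * k2 + 2 <= k1 + k2 + k3 + k4, 2 * k3 + 2 <= k1 + k2 + k3 + k4 &
  2 * k4 + 2 <= k1 + k2 + k3 + k4] by split; lia.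
rewrite uphalf_leq; split.
- move=> wlp.
  have le_pq : d1 + d2 + d3 + d4 <= 2 * (p * q) + 2.
    have dQ k' r' d' : d' = k' * q + r' -> 1 <= k' <= p - 1 -> 0 <= r' <= q - 1 ->
        0 < d' -> forall w, (w * (p * q) + 0 < d') = (w < 1).
      move=> -> kb rb d'0 w; rewrite addn0; case: w => [|w]; first by rewrite mul0n.
      apply/negbTE; rewrite -leqNgt mulSn; apply: leq_trans (leq_addr _ _).
      apply: leq_trans (_ : k'.+1 * q <= _); first by rewrite mulSn; lia.
      by rewrite leq_mul2r; apply/orP; right; lia.
    (* the strings of [1]: all exponents are rounded up to the single multiple of [p * q] *)
    have := @weak_Lefschetz_string_bound K d d_gt0 p e.+1 1 1 1 1 0 0 0 0 0 0 0 charK wlp.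
    rewrite QE -/d1 -/d2 -/d3 -/d4 mul1n !addn0 => bQ.
    apply: bQ => //; [exact: dQ dE1 _ _ _ | exact: dQ dE2 _ _ _ |
      exact: dQ dE3 _ _ _ | exact: dQ dE4 _ _ _].
  have low k' r' d' : d' = k' * q + r' -> forall w, (w * q + r' < d') = (w < k').
    by move=> -> w; apply: digit_low.
  have high k' r' d' : d' = k' * q + r' -> 0 <= r' <= q - 1 -> 0 < r' ->
      forall w, (w * q + 0 < d') = (w < k'.+1).
    by move=> -> rb r0 w; apply: digit_high; lia.
  have L1 := low _ _ _ dE1; have L2 := low _ _ _ dE2.
  have L3 := low _ _ _ dE3; have L4 := low _ _ _ dE4.
  have H1 := high _ _ _ dE1 rb1; have H2 := high _ _ _ dE2 rb2.
  have H3 := high _ _ _ dE3 rb3; have H4 := high _ _ _ dE4 rb4.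
  have bound e1 e2 e3 e4 s1 s2 s3 s4 (S := e1 + e2 + e3 + e4) :
      (forall w, (w * q + s1 < d1) = (w < e1)) -> (forall w, (w * q + s2 < d2) = (w < e2)) ->
      (forall w, (w * q + s3 < d3) = (w < e3)) -> (forall w, (w * q + s4 < d4) = (w < e4)) ->
      k1 <= e1 -> k2 <= e2 -> k3 <= e3 -> k4 <= e4 ->
      2 * e1 + 2 + odd S <= S -> 2 * e2 + 2 + odd S <= S ->
      2 * e3 + 2 + odd S <= S -> 2 * e4 + 2 + odd S <= S ->
      d1 + d2 + d3 + d4 + 2 * q <= (S + odd S) * q + 2 * (s1 + s2 + s3 + s4) + 2.
    move=> g1 g2 g3 g4 *; rewrite q_def in g1 g2 g3 g4 *.
    by apply: weak_Lefschetz_digit_bound wlp g1 g2 g3 g4 _ _ _ _ _ _ _ _ => //; lia.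
  rewrite dsum in bound; set S := k1 + k2 + k3 + k4 in bound kl1 kl2 kl3 kl4 *.
  case: (boolP (odd S)) => oddS; [left | right].
  + have A : q + r4 <= r1 + r2 + r3 + 2.
      (* [r4 = 0] makes all remainders vanish; all exponents are then rounded down *)
      case: (posnP r4) => [r40 | r4_gt0].
        have := bound _ _ _ _ _ _ _ _ L1 L2 L3 L4; rewrite -/S oddS mulnDl mul1n.
        by move/(_ (leqnn _) (leqnn _) (leqnn _) (leqnn _)); lia.
      have := bound _ _ _ _ _ _ _ _ L1 L2 L3 (H4 r4_gt0).
      have -> : k1 + k2 + k3 + k4.+1 = S.+1 by rewrite addnS.
      have -> : odd S.+1 = false by rewrite /= oddS.
      rewrite !addn0 mulSn => /(_ (leqnn _) (leqnn _) (leqnn _) (leqnSn _)).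
      by lia.
    have B : r2 + r3 + r4 <= q + r1 + 2.
      case: (posnP r2) => [r20 | r2_gt0]; first by lia.
      have := bound _ _ _ _ _ _ _ _ L1 (H2 r2_gt0) (H3 _) (H4 _).
      have -> : k1 + k2.+1 + k3.+1 + k4.+1 = S.+3 by rewrite /S; lia.
      have -> : odd S.+3 = false by rewrite /= oddS.
      have r3_gt0 := leq_trans r2_gt0 le23.
      rewrite !addn0 !mulSn => /(_ r3_gt0 (leq_trans r3_gt0 le34)).
      by move/(_ (leqnn _) (leqnSn _) (leqnSn _) (leqnSn _)); lia.
    by split; lia.
  have C : 2 * q <= r1 + r2 + r3 + r4 + 2.
    have := bound _ _ _ _ _ _ _ _ L1 L2 L3 L4; rewrite -/S (negPf oddS) !addn0.
    by move/(_ (leqnn _) (leqnn _) (leqnn _) (leqnn _)); lia.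
  have D : r3 + r4 <= r1 + r2 + 2.
    case: (posnP r3) => [r30 | r3_gt0]; first by lia.
    have := bound _ _ _ _ _ _ _ _ L1 L2 (H3 r3_gt0) (H4 (leq_trans r3_gt0 le34)).
    have -> : k1 + k2 + k3.+1 + k4.+1 = S.+2 by rewrite /S; lia.
    have -> : odd S.+2 = false by rewrite /= negbK (negPf oddS).
    rewrite !addn0 !mulSn => /(_ (leqnn _) (leqnn _) (leqnSn _) (leqnSn _)).
    by lia.
  have E : r1 + r2 + r3 + r4 <= 2 * q + 2.
    case: (posnP r1) => [r10 | r1_gt0]; first by lia.
    have r2_gt0 := leq_trans r1_gt0 le12; have r3_gt0 := leq_trans r2_gt0 le23.
    have r4_gt0 := leq_trans r3_gt0 le34.
    have := bound _ _ _ _ _ _ _ _ (H1 r1_gt0) (H2 r2_gt0) (H3 r3_gt0) (H4 r4_gt0).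
    have -> : k1.+1 + k2.+1 + k3.+1 + k4.+1 = S.+4 by rewrite /S; lia.
    have -> : odd S.+4 = false by rewrite /= !negbK (negPf oddS).
    rewrite !addn0 !mulSn => /(_ (leqnSn _) (leqnSn _) (leqnSn _) (leqnSn _)).
    by lia.
  by split; lia.
move=> cond; apply: weak_Lefschetz_of_kernel.
rewrite -/(lower_half_injective K _ _ _ _) -/d1 -/d2 -/d3 -/d4.
have le_Q : d1 + d2 + d3 + d4 <= 2 * p ^ e.+1 + 2 by rewrite QE; case: cond => [][]; lia.
case: (even_prime pr_p) => [p2 | odd_p].
  (* every [k i] is 1 and the bound on [p * q] leaves only the exponents 2, 2, 3, 3 *)
  have [k11 k21 k31 k41] : [/\ k1 = 1, k2 = 1, k3 = 1 & k4 = 1] by split; lia.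
  rewrite k11 k21 k31 k41 p2 /= in cond dsum.
  have [r10 r20 r31 r41 q2] : [/\ r1 = 0, r2 = 0, r3 = 1, r4 = 1 & q = 2].
    by case: cond => [[] // | [_ ? ? ?]]; split; lia.
  have e1 : e = 1.
    apply/eqP; rewrite -(@eqn_exp2l 2) // expn1 -p2 -q_def q2; exact/eqP/esym.
  have nk : powers_injective K (p ^ e.+1) 2 3 0.
    apply: powers_injective_central => //; rewrite ?e1 ?p2 // => f f1.
    by have -> : f = 1 by lia.
  rewrite dE1 dE2 dE3 dE4 k11 k21 k31 k41 r10 r20 r31 r41 q2 in le_Q *.
  by apply/lower_half_injective_swap23/(lower_half_injective_pair nk nk) => //; left.
have [q3 oddq] : 3 <= q /\ odd q.
  by rewrite q_def oddX odd_p orbT ge3_odd_power.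
have qE : q = (q./2).*2.+1 by rewrite -{1}(odd_double_half q) oddq.
have half_gt0 : 0 < q./2 by lia.
have inj_mid k' l' r' s' : 0 < k' <= p - 1 -> 0 < l' <= p - 1 ->
    (r' = q./2 \/ r' = q./2.+1) -> (s' = q./2 \/ s' = q./2.+1) ->
    powers_injective K (p ^ e.+1) (k' * q + r') (l' * q + s') 0.
  by rewrite q_def => *; apply: powers_injective_half => //; lia.
have inj_near k' l' r' s' : 0 < k' <= p - 1 -> 0 < l' <= p - 1 ->
    r'.+1 = q./2 \/ r' = q./2.+2 -> r' <= q - 1 -> (s' = q./2 \/ s' = q./2.+1) ->
    powers_injective K (p ^ e.+1) (k' * q + r') (l' * q + s') 1.
  by move: q0; rewrite q_def => *; apply: powers_injective_near_half => //; lia.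
have even_sum : odd (r1 + r2 + r3 + r4) = odd (k1 + k2 + k3 + k4) ->
    ~~ odd (d1 + d2 + d3 + d4).
  by move=> ev; rewrite dsum oddD oddM oddq andbT ev addbb.
have := @remainder_cases q./2 r1 r2 r3 r4 (odd (k1 + k2 + k3 + k4)) half_gt0 le12 le23 le34.
rewrite -qE => cases.
case: cases => [|[m1 m2 m3 m4]|[m1 m2 m3 m4 ev]|[m1 m2 m3 m4 ev]].
- by case: cond => [[oS h1 h2 _] | [oS h1 h2 _]]; [left | right]; split; lia.
- rewrite dE1 dE2 dE3 dE4 in le_Q *.
  apply: (lower_half_injective_pair (inj_mid _ _ _ _ _ _ _ _) (inj_mid _ _ _ _ _ _ _ _) le_Q)
    => //.
  by left.
- have ev_sum := even_sum ev; rewrite dE1 dE2 dE3 dE4 in le_Q ev_sum *.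
  apply: (lower_half_injective_pair (inj_near _ _ _ _ _ _ _ _ _) (inj_mid _ _ _ _ _ _ _ _) le_Q)
    => //.
    by left.
  by right.
have ev_sum := even_sum ev; rewrite dE1 dE2 dE3 dE4 in le_Q ev_sum *.
apply: lower_half_injective_rev.
apply: (lower_half_injective_pair (inj_near _ _ _ _ _ _ _ _ _) (inj_mid _ _ _ _ _ _ _ _) _)
  => //.
- by right.
- by lia.
- by right; split=> //; move: ev_sum; rewrite -!addnA; congr (~~ odd _); lia.
Qed.
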